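(* Let $\chi$ be an extremal character of $S_\infty$ with Thoma parameters $(\{\alpha_i\}_{i\in\mathbb{N}},\{\beta_j\}_{j\in\mathbb{N}})$. Then $\chi$ is a Yang-Baxter character, i.e. $\chi=\chi_R$ for some involutive R-matrix $R$, if and only if the following three conditions all hold: (i) only finitely many of the $\alpha_i,\beta_j$ are non-zero; (ii) $\sum_i\alpha_i+\sum_j\beta_j=1$; (iii) all $\alpha_i,\beta_j$ are rational. Moreover, if $R$ is an involutive R-matrix of dimension $d$ and $(\alpha,\beta)$ are the Thoma parameters of $\chi_R$, then $d\alpha_i$ and $d\beta_i$ are non-negative integers for all $i$.
   Context: $\mathbb{N}=\{1,2,\dots\}$. Let $V$ be a nonzero finite-dimensional complex Hilbert space. An involutive R-matrix with base space $V$ and dimension $d=\dim V$ is a unitary $R\in\mathrm{End}(V\otimes V)$ with $R^2=1$ satisfying the Yang-Baxter equation $(R\otimes \mathrm{id}_V)(\mathrm{id}_V\otimes R)(R\otimes \mathrm{id}_V)=(\mathrm{id}_V\otimes R)(R\otimes \mathrm{id}_V)(\mathrm{id}_V\otimes R)$. For $n\in\mathbb{N}$ it defines a unitary representation $\rho_R^{(n)}$ of $S_n$ on $V^{\otimes n}$ by sending $(k,k+1)$ to $\mathrm{id}_V^{\otimes(k-1)}\otimes R\otimes\mathrm{id}_V^{\otimes(n-k-1)}$. $S_\infty=\bigcup_n S_n$ is the group of bijections of $\mathbb{N}$ moving only finitely many points. A character of $S_\infty$ is a positive definite class function $\chi:S_\infty\to\mathbb{C}$ with $\chi(e)=1$;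 it is extremal if it is an extreme point of the convex set of characters. The Yang-Baxter character of $R$ is $\chi_R(\sigma)=d^{-n}\,\mathrm{Tr}_{V^{\otimes n}}(\rho_R^{(n)}(\sigma))$ for $\sigma\in S_n$ (independent of the choice of $n$); it is an extremal character. By Thoma's theorem, extremal characters of $S_\infty$ are in bijection with pairs of sequences of real numbers $(\{\alpha_i\}_{i\in\mathbb{N}},\{\beta_i\}_{i\in\mathbb{N}})$ with $\alpha_i\ge\alpha_{i+1}\ge0$, $\beta_i\ge\beta_{i+1}\ge0$ and $\sum_i\alpha_i+\sum_j\beta_j\le1$ (the Thoma parameters of $\chi$), the bijection being determined by $\chi(c_n)=\sum_i\alpha_i^n+(-1)^{n+1}\sum_i\beta_i^n$ for every $n$-cycle $c_n$, $n\ge2$, together with multiplicativity over disjoint cycles. *)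

(* Defs.v *)
From HB Require Import structures.
From mathcomp Require Import all_boot all_order all_algebra.
From mathcomp Require Import spectral complex mxtens.
From mathcomp Require Import all_classical all_reals all_analysis.
From mathcomp Require Import zify.

Set Implicit Arguments.
Unset Strict Implicit.
Unset Printing Implicit Defensive.

Import Order.TTheory GRing.Theory Num.Theory numFieldNormedType.Exports.
Local Open Scope classical_set_scope.
Local Open Scope ring_scope.

(* The group of finitary permutations, acting on [nat] = {0, 1, 2, ...} in
   place of {1, 2, 3, ...}; the product is composition, (s * t) i = s (t i). *)
Record Sinf := MkSinf {
  sinf_fun :> nat -> nat;
  sinf_bij : bijective sinf_fun;
  sinf_fin : finite_set [set i | sinf_fun i != i] }.

HB.instance Definition _ := gen_eqMixin Sinf.
HB.instance Definition _ := gen_choiceMixin Sinf.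

Lemma sinfP (s t : Sinf) : s =1 t -> s = t.
Proof.
case: s t => [f fb ff] [g gb gf] /= /funext E; subst g.
by congr MkSinf; exact: Prop_irrelevance.
Qed.

Lemma sinf_inv_ex (s : Sinf) : exists g : nat -> nat, cancel s g /\ cancel g s.
Proof. by case: (sinf_bij s) => g ? ?; exists g. Qed.

Definition sinf_inv_fun (s : Sinf) : nat -> nat := sval (cid (sinf_inv_ex s)).

Lemma sinf_funK (s : Sinf) : cancel s (sinf_inv_fun s).
Proof. by rewrite /sinf_inv_fun; case: cid => g []. Qed.

Lemma sinf_invfunK (s : Sinf) : cancel (sinf_inv_fun s) s.
Proof. by rewrite /sinf_inv_fun; case: cid => g []. Qed.

Lemma sinf_inv_bij (s : Sinf) : bijective (sinf_inv_fun s).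
Proof. exact: Bijective (sinf_invfunK s) (sinf_funK s). Qed.

Lemma sinf_inv_fin (s : Sinf) : finite_set [set i | sinf_inv_fun s i != i].
Proof.
apply: sub_finite_set (sinf_fin s) => i /=; apply: contraNN => /eqP {1}<-.
by rewrite sinf_funK.
Qed.

Definition sinf_inv (s : Sinf) : Sinf :=
  MkSinf (sinf_inv_bij s) (sinf_inv_fin s).

Lemma sinf_one_fin : finite_set [set i : nat | id i != i].
Proof. by apply: sub_finite_set (finite_set0 nat) => i /=; rewrite eqxx. Qed.

Definition sinf_one : Sinf := MkSinf (Bijective (frefl id) (frefl id)) sinf_one_fin.

Lemma sinf_mul_fin (s t : Sinf) : finite_set [set i | (s \o t) i != i].
Proof.
have : finite_set ([set i | s i != i] `|` [set i | t i != i]).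
  by rewrite finite_setU; split; exact: sinf_fin.
apply: sub_finite_set => i /=.
by case: (eqVneq (t i) i) => [->|]; [left|right].
Qed.

Definition sinf_mul (s t : Sinf) : Sinf :=
  MkSinf (bij_comp (sinf_bij s) (sinf_bij t)) (sinf_mul_fin s t).

Lemma sinf_mulA : associative sinf_mul.
Proof. by move=> s t u; apply: sinfP. Qed.
Lemma sinf_mul1 : left_id sinf_one sinf_mul.
Proof. by move=> s; apply: sinfP. Qed.
Lemma sinf_1mul : right_id sinf_one sinf_mul.
Proof. by move=> s; apply: sinfP. Qed.
Lemma sinf_mulV : left_inverse sinf_one sinf_inv sinf_mul.
Proof. by move=> s; apply: sinfP => i /=; rewrite sinf_funK. Qed.
Lemma sinf_Vmul : right_inverse sinf_one sinf_inv sinf_mul.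
Proof. by move=> s; apply: sinfP => i /=; rewrite sinf_invfunK. Qed.

HB.instance Definition _ := isGroup.Build Sinf
  sinf_mulA sinf_mul1 sinf_1mul sinf_mulV sinf_Vmul.

(* [sinf_stab n] is S_n inside S_infinity. *)
Definition sinf_stab (n : nat) : set Sinf :=
  [set s | forall i, (n <= i)%N -> s i = i].

Definition adj_fun (k i : nat) : nat :=
  if i == k then k.+1 else if i == k.+1 then k else i.

Lemma adj_funE k i : i = k /\ adj_fun k i = k.+1 \/
  i = k.+1 /\ adj_fun k i = k \/ i <> k /\ i <> k.+1 /\ adj_fun k i = i.
Proof. by rewrite /adj_fun; case: eqP => ?; [left|right; case: eqP => ?; [left|right]]. Qed.

Lemma adj_funK k : involutive (adj_fun k).
Proof. by move=> i; have := adj_funE k i; have := adj_funE k (adj_fun k i); lia. Qed.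

Lemma adj_fun_fin k : finite_set [set i | adj_fun k i != i].
Proof.
apply: sub_finite_set (finite_II k.+2) => i /=.
by have := (adj_funE k i); lia.
Qed.

Definition adj (k : nat) : Sinf :=
  MkSinf (Bijective (adj_funK k) (adj_funK k)) (adj_fun_fin k).

Lemma sinf_stab1 n : sinf_stab n 1%g.
Proof. by []. Qed.

Lemma sinf_stabM n s t : sinf_stab n s -> sinf_stab n t -> sinf_stab n (s * t)%g.
Proof. by move=> hs ht i hi /=; rewrite ht ?hs. Qed.

Lemma sinf_stab_adj n k : (k.+1 < n)%N -> sinf_stab n (adj k).
Proof. by move=> hk i hi /=; have := (adj_funE k i); lia. Qed.

Lemma sinf_stabS n m s : (n <= m)%N -> sinf_stab n s -> sinf_stab m s.
Proof. by move=> nm hs i /(leq_trans nm)/hs. Qed.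

Lemma sinf_stab_ex s : exists n, (0 < n)%N /\ sinf_stab n s.
Proof.
have [m hm] : exists m, forall i, (m <= i)%N -> s i = i.
  have /finite_seqP[X EX] := sinf_fin s.
  exists (\max_(i <- X) i).+1 => i hi; apply/eqP/negPn/negP => si.
  have : [set` X] i by rewrite -EX.
  rewrite /= => iX; have := leq_bigmax_seq (P := xpredT) (F := fun i : nat => i) _ iX isT.
  by rewrite leqNgt hi.
by exists m.+1; split=> // i hi; apply: hm; lia.
Qed.

Lemma sinf_inj (s : Sinf) : injective s.
Proof. exact: bij_inj (sinf_bij s). Qed.

Lemma sinf_stab_lt n s i : sinf_stab n s -> (i < n)%N -> (s i < n)%N.
Proof.
move=> hs hi; rewrite ltnNge; apply/negP => h.
by have := hs _ h => /sinf_inj; lia.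
Qed.

Lemma adjK k s : (adj k * (adj k * s))%g = s.
Proof. by apply: sinfP => i /=; rewrite adj_funK. Qed.

(* S_n is generated by the adjacent transpositions. *)
Lemma sinf_stab_ind n (P : Sinf -> Prop) :
    P 1%g -> (forall k s, (k.+1 < n)%N -> sinf_stab n s -> P s -> P (adj k * s)%g) ->
  forall s, sinf_stab n s -> P s.
Proof.
elim: n P => [|n IHn] P P1 PM.
  by move=> s hs; rewrite (_ : s = 1%g) //; apply: sinfP => i; exact: hs.
move=> s; move: {2}(n - s n)%N (erefl (n - s n)%N) => m.
elim: m s => [|m IHm] s Em hs.
  have sn : s n = n by have := sinf_stab_lt hs (ltnSn n); lia.
  apply: (IHn P) => //; last first.
    move=> i; rewrite leq_eqVlt => /orP[/eqP <- //|]; exact: hs.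
  by move=> k t hk ht Pt; apply: PM => //; [lia|exact: sinf_stabS ht].
have sn : (s n < n)%N by lia.
rewrite -(adjK (s n) s); apply: PM => //.
  by apply: sinf_stabM => //; exact: sinf_stab_adj.
apply: IHm; last by apply: sinf_stabM => //; exact: sinf_stab_adj.
by rewrite /= /adj_fun eqxx; lia.
Qed.

Lemma unbump_spec h k :
  (h < k)%N /\ unbump h k = k.-1 \/ (k <= h)%N /\ unbump h k = k.
Proof. by rewrite /unbump; case: ltnP => ?; [left|right]; lia. Qed.

Ltac unbump_adj_tac h h' k k' y :=
  have := adj_funE k y; have := adj_funE k' (unbump h' y);
  have := unbump_spec h (adj_fun k y); have := unbump_spec h' y;
  lia.

Lemma unbump_adj1 h k y : (k.+1 < h)%N -> y <> h ->
  unbump h (adj_fun k y) = adj_fun k (unbump h y).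
Proof. move=> hk hy; unbump_adj_tac h h k k y. Qed.

Lemma unbump_adj2 k y : y <> k.+1 -> unbump k (adj_fun k y) = unbump k.+1 y.
Proof. move=> hy; unbump_adj_tac k k.+1 k k y. Qed.

Lemma unbump_adj3 k y : y <> k -> unbump k.+1 (adj_fun k y) = unbump k y.
Proof. move=> hy; unbump_adj_tac k.+1 k k k y. Qed.

Lemma unbump_adj4 h k y : (h < k.+1)%N -> y <> h ->
  unbump h (adj_fun k.+1 y) = adj_fun k (unbump h y).
Proof. move=> hk hy; unbump_adj_tac h h k.+1 k y. Qed.

(* Elements of a ring satisfying the Coxeter relations of S_N extend to a
   multiplicative map on S_N (lemmas [cox1], [coxM], [cox_gen]). *)
Section Coxeter.
Variables (A : pzRingType) (r : nat -> A).

Fixpoint cox (n : nat) (f : nat -> nat) : A :=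
  if n is m.+1 then (\prod_(f m <= i < m) r i) * cox m (unbump (f m) \o f)
  else 1.

Lemma eq_cox n f g : (forall i, (i < n)%N -> f i = g i) -> cox n f = cox n g.
Proof.
elim: n f g => //= n IHn f g fg; rewrite fg //; congr (_ * _).
by apply: IHn => i hi /=; rewrite fg // ltnS ltnW.
Qed.

Lemma cox1 n : cox n id = 1.
Proof.
elim: n => //= n IHn; rewrite big_geq // mul1r -IHn.
by apply: eq_cox => i hi /=; rewrite /unbump ltnNge ltnW // subn0.
Qed.

Definition maps_below n (f : nat -> nat) :=
  (forall i, (i < n)%N -> (f i < n)%N) /\
  (forall i j, (i < n)%N -> (j < n)%N -> f i = f j -> i = j).

Variable N : nat.
Hypothesis r_invol : forall k, (k.+1 < N)%N -> r k * r k = 1.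
Hypothesis r_braid : forall k, (k.+2 < N)%N ->
  r k * r k.+1 * r k = r k.+1 * r k * r k.+1.
Hypothesis r_comm : forall k l, (k.+1 < l)%N -> (l.+1 < N)%N ->
  r k * r l = r l * r k.

Lemma cox_adj n f k : (n <= N)%N -> maps_below n f -> (k.+1 < n)%N ->
  cox n (adj_fun k \o f) = r k * cox n f.
Proof.
elim: n f k => // n IHn f k nN [flt finj] kn.
have fn : (f n < n.+1)%N by exact: flt.
have fneq i : (i < n)%N -> f i <> f n.
  by move=> hi /finj; lia.
have mb : maps_below n (unbump (f n) \o f).
  split=> [i hi|i j hi hj] /=.
    by have := flt i; have := fneq i hi; have := unbump_spec (f n) (f i); lia.
  move=> E; apply: finj; [lia|lia|].
  by have := fneq i hi; have := fneq j hj; have := unbump_spec (f n) (f i);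
    have := unbump_spec (f n) (f j); move: E => /=; lia.
have prodC a m : (k.+1 < a)%N -> (m <= n)%N ->
    (\prod_(a <= i < m) r i) * r k = r k * \prod_(a <= i < m) r i.
  move=> ka mn; rewrite big_seq; apply: (big_ind (fun x => x * r k = r k * x)).
  - by rewrite mul1r mulr1.
  - by move=> x y Hx Hy; rewrite -mulrA Hy mulrA Hx mulrA.
  - by move=> i; rewrite mem_index_iota => hi; rewrite (@r_comm k i) //; lia.
rewrite /=; have [kj|kj] := ltnP k.+1 (f n).
- have -> : adj_fun k (f n) = f n by have := (adj_funE k (f n)); lia.
  rewrite mulrA -prodC // -mulrA -IHn //; [|lia|lia].
  congr (_ * _); apply: eq_cox => i hi /=.
  by apply: unbump_adj1; have := fneq i hi; lia.
have [kj1|kj1] := eqVneq (f n) k.+1.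
  have -> : adj_fun k (f n) = k by have := (adj_funE k (f n)); lia.
  rewrite kj1 mulrA -big_ltn; last lia.
  congr (_ * _); apply: eq_cox => i hi /=.
  by apply: unbump_adj2; have := fneq i hi; lia.
have [kj2|kj2] := eqVneq (f n) k.
  have -> : adj_fun k (f n) = k.+1 by have := (adj_funE k (f n)); lia.
  rewrite kj2 [in RHS]big_ltn; last lia.
  rewrite !mulrA r_invol ?mul1r; last lia.
  congr (_ * _); apply: eq_cox => i hi /=.
  by apply: unbump_adj3; have := fneq i hi; lia.
have jk : (f n < k)%N by lia.
have -> : adj_fun k (f n) = f n by have := (adj_funE k (f n)); lia.
case: k kn prodC kj kj1 kj2 jk => // k kn prodC kj kj1 kj2 jk.
have -> : cox n (unbump (f n) \o (adj_fun k.+1 \o f)) =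
          r k * cox n (unbump (f n) \o f).
  rewrite -IHn //; [|lia].
  apply: eq_cox => i hi /=.
  by apply: unbump_adj4; have := fneq i hi; lia.
rewrite !mulrA; congr (_ * _).
have prodC1 m : (f n <= m)%N -> (m <= k)%N ->
    r k.+1 * (\prod_(f n <= i < m) r i) = (\prod_(f n <= i < m) r i) * r k.+1.
  move=> fm mk; rewrite big_seq; apply: (big_ind (fun x => r k.+1 * x = x * r k.+1)).
  - by rewrite mul1r mulr1.
  - by move=> x y Hx Hy; rewrite mulrA Hx -mulrA Hy mulrA.
  - by move=> i; rewrite mem_index_iota => hi; rewrite (@r_comm i k.+1) //; lia.
have prodC2 m : (m <= n)%N ->
    (\prod_(k.+2 <= i < m) r i) * r k = r k * \prod_(k.+2 <= i < m) r i.
  move=> mn; rewrite big_seq; apply: (big_ind (fun x => x * r k = r k * x)).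
  - by rewrite mul1r mulr1.
  - by move=> x y Hx Hy; rewrite -mulrA Hy mulrA Hx mulrA.
  - by move=> i; rewrite mem_index_iota => hi; rewrite (@r_comm k i) //; lia.
rewrite (big_cat_nat (n := k)) //=; [|lia].
rewrite (big_ltn (m := k)); [|lia]; rewrite (big_ltn (m := k.+1)); [|lia].
rewrite -[in LHS]mulrA -[X in _ * X = _]mulrA -[X in _ * (_ * X) = _]mulrA prodC2 //.
rewrite [in RHS]mulrA prodC1 //.
by rewrite -!mulrA; congr (_ * _); rewrite !mulrA r_braid //; lia.
Qed.

Lemma coxM s t : sinf_stab N s -> sinf_stab N t ->
  cox N (s * t)%g = cox N s * cox N t.
Proof.
have mb u : sinf_stab N u -> maps_below N u.
  move=> hu; split=> [i|i j _ _]; first exact: sinf_stab_lt.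
  exact: sinf_inj.
move=> hs ht; elim/sinf_stab_ind : hs => [|k u hk hu IH].
  by rewrite mul1g [X in _ = X * _]cox1 mul1r.
rewrite -mulgA (cox_adj _ (mb _ (sinf_stabM hu ht))) // IH.
by rewrite [X in _ = X * _](cox_adj _ (mb _ hu)) // mulrA.
Qed.

Lemma cox_gen k : (k.+1 < N)%N -> cox N (adj k) = r k.
Proof.
move=> hk; have /= := @cox_adj N id k (leqnn _) _ hk.
by rewrite cox1 mulr1; apply; split.
Qed.

End Coxeter.

(* The base space is V = C^d with its standard inner product; V^{(x) n} is
   C^(d ^ n), and [*t] is the Kronecker product. *)
Section RMatrix.
Variables (K : realType) (d : nat).
Local Notation C := K[i].
Implicit Type R : 'M[C]_(d * d).

Definition yang_baxter R : Prop :=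
  let R12 := R *t (1%:M : 'M[C]_d) in
  let R23 := castmx (mulnA d d d, mulnA d d d) ((1%:M : 'M[C]_d) *t R) in
  R12 *m R23 *m R12 = R23 *m R12 *m R23.

Definition involutive_Rmatrix R : Prop :=
  [/\ R \is unitarymx, R *m R = 1%:M & yang_baxter R].

(* id^{(x) k} (x) R (x) id^{(x) (n-k-2)}, the image of [adj k]. The two
   dimensions agree when k + 1 < n; outside that range the value is unused. *)
Definition yb_gen R (n k : nat) : 'M[C]_(d ^ n) :=
  conform_mx 1%:M
    ((1%:M : 'M[C]_(d ^ k)) *t R *t (1%:M : 'M[C]_(d ^ (n - k - 2)))).

Definition is_yb_rep R (n : nat) (rho : Sinf -> 'M[C]_(d ^ n)) : Prop :=
  [/\ rho 1%g = 1%:M,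
      {in sinf_stab n &, forall s t, rho (s * t)%g = rho s *m rho t} &
      forall k, (k.+1 < n)%N -> rho (adj k) = yb_gen R n k].

(* For an involutive R-matrix such a [rho] exists (lemma [yb_repP]) and its
   restriction to S_n is unique, so the choice is immaterial. *)
Definition yb_rep R (n : nat) : Sinf -> 'M[C]_(d ^ n) :=
  xget (fun=> 1%:M) [set rho | is_yb_rep R rho].

(* Any n >= 1 with s in S_n gives the same value (lemma [yb_charE]). *)
Definition yb_char R (s : Sinf) : C :=
  let n := xget 1%N [set n | (0 < n)%N /\ sinf_stab n s] in
  (d%:R ^+ n)^-1 * \tr (yb_rep R n s).

End RMatrix.

(* Equality of square matrices up to a cast of the dimension. *)
Section TensorLemmas.
Variable A : comPzRingType.

Definition mxsim m n (X : 'M[A]_m) (Y : 'M[A]_n) :=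
  exists e : m = n, castmx (e, e) X = Y.

Lemma mxsim_refl m (X : 'M[A]_m) : mxsim X X.
Proof. by exists erefl. Qed.

Lemma mxsim_sym m n (X : 'M[A]_m) (Y : 'M[A]_n) : mxsim X Y -> mxsim Y X.
Proof. by case=> e <-; case: n / e Y => Y; rewrite castmx_id; exists erefl. Qed.

Lemma mxsim_trans m n p (X : 'M[A]_m) (Y : 'M[A]_n) (Z : 'M[A]_p) :
  mxsim X Y -> mxsim Y Z -> mxsim X Z.
Proof. by case=> e <- [e' <-]; rewrite castmx_comp; exists (etrans e e'). Qed.

Lemma mxsim_castmx m n (e e' : m = n) (X : 'M[A]_m) : mxsim X (castmx (e, e') X).
Proof. by exists e; rewrite (eq_irrelevance e e'). Qed.

Lemma mxsim_tens m n p q (X : 'M[A]_m) (Y : 'M[A]_n) (Z : 'M[A]_p) (T : 'M[A]_q) :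
  mxsim X Y -> mxsim Z T -> mxsim (X *t Z) (Y *t T).
Proof.
move=> [e <-] [e' <-]; case: n / e Y => Y; case: q / e' T => T.
by rewrite !castmx_id; exact: mxsim_refl.
Qed.

Lemma mxsim_tensA m n p (X : 'M[A]_m) (Y : 'M[A]_n) (Z : 'M[A]_p) :
  mxsim (X *t (Y *t Z)) (X *t Y *t Z).
Proof.
exists (mulnA m n p); apply/matrixP => i j; rewrite castmxE !mxE mulrA /=.
have E1 (i' : nat) : (i' %/ (n * p) = i' %/ p %/ n)%N by rewrite mulnC divnMA.
have E2 (i' : nat) : (i' %% (n * p) %/ p = i' %/ p %% n)%N.
  by rewrite modn_divl.
have E3 (i' : nat) : (i' %% (n * p) %% p = i' %% p)%N.
  by rewrite modn_dvdm // dvdn_mull.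
by congr (X _ _ * Y _ _ * Z _ _); apply: val_inj; rewrite /= ?E1 ?E2 ?E3.
Qed.

Lemma tensmx11 m n : (1%:M : 'M[A]_m) *t (1%:M : 'M[A]_n) = 1%:M.
Proof.
apply/matrixP => i j; case: (mxtens_indexP i) => i1 i2.
case: (mxtens_indexP j) => j1 j2; rewrite tensmxE !mxE.
rewrite (inj_eq (can_inj (@mxtens_indexK m n))) xpair_eqE.
by case: eqP => _; case: eqP => _; rewrite ?mulr0 ?mulr1.
Qed.

Lemma mxsim_1 m n : m = n -> mxsim (1%:M : 'M[A]_m) (1%:M : 'M[A]_n).
Proof. by move=> ->; exact: mxsim_refl. Qed.

Lemma conform_mxsim m n p (B : 'M[A]_p) (X : 'M[A]_m) (Y : 'M[A]_n) :
  mxsim X Y -> conform_mx B X = conform_mx B Y.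
Proof. by case=> e <-; rewrite conform_castmx. Qed.

Lemma mxsim_conform m n (B : 'M[A]_n) (X : 'M[A]_m) :
  m = n -> mxsim X (conform_mx B X).
Proof. by move=> e; subst m; rewrite conform_mx_id; exact: mxsim_refl. Qed.

Lemma mxsimM m n (X X' : 'M[A]_m) (Y Y' : 'M[A]_n) :
  mxsim X Y -> mxsim X' Y' -> mxsim (X *m X') (Y *m Y').
Proof.
move=> [e <-] [e' <-]; rewrite (eq_irrelevance e' e); case: n / e Y Y' e' => *.
by rewrite !castmx_id; exact: mxsim_refl.
Qed.

Lemma mxsim_eq m (X Y : 'M[A]_m) : mxsim X Y -> X = Y.
Proof. by case=> e <-; rewrite castmx_id. Qed.

Lemma mxsim_tr m n (X : 'M[A]_m) (Y : 'M[A]_n) : mxsim X Y -> \tr X = \tr Y.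
Proof. by case=> e <-; case: n / e Y => Y; rewrite castmx_id. Qed.

Lemma mxtrace_tens m n (X : 'M[A]_m) (Y : 'M[A]_n) : \tr (X *t Y) = \tr X * \tr Y.
Proof. by rewrite /mxtrace mulr_sum; apply: eq_bigr => i _; rewrite mxE. Qed.

End TensorLemmas.

Section YBRep.
Variables (K : realType) (d : nat).
Local Notation C := K[i].
Variable R : 'M[C]_(d * d).
Hypothesis hR : involutive_Rmatrix R.
Local Notation I n := (1%:M : 'M[C]_n).

Lemma yb_gen_sim n k : (k.+1 < n)%N ->
  mxsim (I (d ^ k) *t R *t I (d ^ (n - k - 2))) (yb_gen R n k).
Proof.
move=> kn; apply: mxsim_conform; rewrite mulnn -!expnD; congr (_ ^ _)%N; lia.
Qed.

Lemma mxsim_ids m n p : m = (n * p)%N -> mxsim (I m) (I n *t I p).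
Proof. by rewrite tensmx11; exact: mxsim_1. Qed.

Lemma yb_gen_tens n k : (k.+1 < n)%N ->
  mxsim (yb_gen R n k *t I d) (yb_gen R n.+1 k).
Proof.
move=> kn; apply: mxsim_trans (yb_gen_sim _); last lia.
apply: mxsim_trans; first exact: mxsim_tens (mxsim_sym (yb_gen_sim kn)) (mxsim_refl _).
apply: mxsim_trans; first exact: mxsim_sym (mxsim_tensA _ _ _).
apply: mxsim_tens; first exact: mxsim_refl.
apply: mxsim_sym; apply: mxsim_ids; rewrite -expnSr; congr (_ ^ _)%N; lia.
Qed.

Lemma yb_gen_invol n k : (k.+1 < n)%N -> yb_gen R n k *m yb_gen R n k = 1%:M.
Proof.
move=> kn; have [_ R2 _] := hR; have h := yb_gen_sim kn.
apply: mxsim_eq; apply: mxsim_trans; first exact: mxsim_sym (mxsimM h h).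
rewrite !tensmx_mul R2 !mulmx1 !tensmx11; apply: mxsim_1.
by case: h.
Qed.

Lemma yb_gen_braid n k : (k.+2 < n)%N ->
  yb_gen R n k *m yb_gen R n k.+1 *m yb_gen R n k =
  yb_gen R n k.+1 *m yb_gen R n k *m yb_gen R n k.+1.
Proof.
move=> kn; have [_ _] := hR; rewrite /yang_baxter.
set R12 := R *t _; set R23 := castmx _ _ => ybe.
have h1 : mxsim (yb_gen R n k) (I (d ^ k) *t R12 *t I (d ^ (n - k - 3))).
  apply: mxsim_trans; first by apply: mxsim_sym; apply: yb_gen_sim; lia.
  apply: mxsim_trans; last exact: mxsim_tens (mxsim_sym (mxsim_tensA _ _ _)) (mxsim_refl _).
  apply: mxsim_trans; last exact: mxsim_tensA.
  apply: mxsim_tens; first exact: mxsim_refl.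
  by apply: mxsim_ids; rewrite -expnS; congr (_ ^ _)%N; lia.
have h2 : mxsim (yb_gen R n k.+1) (I (d ^ k) *t R23 *t I (d ^ (n - k - 3))).
  apply: mxsim_trans; first by apply: mxsim_sym; apply: yb_gen_sim; lia.
  apply: mxsim_tens; last by apply: mxsim_1; congr (_ ^ _)%N; lia.
  apply: mxsim_trans (mxsim_tens (mxsim_refl _) (mxsim_castmx _ _ _)).
  apply: mxsim_trans; last exact: mxsim_sym (mxsim_tensA _ _ _).
  apply: mxsim_tens; last exact: mxsim_refl.
  by apply: mxsim_ids; rewrite expnSr.
apply: mxsim_eq; apply: mxsim_trans; first exact: mxsimM (mxsimM h1 h2) h1.
rewrite !tensmx_mul !mulmx1 ybe; apply: mxsim_sym.
apply: mxsim_trans; first exact: mxsimM (mxsimM h2 h1) h2.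
by rewrite !tensmx_mul !mulmx1; exact: mxsim_refl.
Qed.

Lemma yb_gen_comm n k l : (k.+1 < l)%N -> (l.+1 < n)%N ->
  yb_gen R n k *m yb_gen R n l = yb_gen R n l *m yb_gen R n k.
Proof.
move=> kl ln.
pose P := I (d ^ k) *t R *t I (d ^ (l - k - 2)).
pose Q := R *t I (d ^ (n - l - 2)).
have h1 : mxsim (yb_gen R n k) (P *t I (d * d * d ^ (n - l - 2))).
  apply: mxsim_trans; first by apply: mxsim_sym; apply: yb_gen_sim; lia.
  apply: mxsim_trans; last exact: mxsim_tensA.
  apply: mxsim_tens; first exact: mxsim_refl.
  by apply: mxsim_ids; rewrite mulnn -!expnD; congr (_ ^ _)%N; lia.
have h2 : mxsim (yb_gen R n l) (I (d ^ k * (d * d) * d ^ (l - k - 2)) *t Q).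
  apply: mxsim_trans; first by apply: mxsim_sym; apply: yb_gen_sim; lia.
  apply: mxsim_trans; first exact: mxsim_sym (mxsim_tensA _ _ _).
  apply: mxsim_tens; last exact: mxsim_refl.
  by apply: mxsim_1; rewrite mulnn -!expnD; congr (_ ^ _)%N; lia.
apply: mxsim_eq; apply: mxsim_trans; first exact: mxsimM h1 h2.
apply: mxsim_sym; apply: mxsim_trans; first exact: mxsimM h2 h1.
by rewrite !tensmx_mul !mulmx1 !mul1mx; exact: mxsim_refl.
Qed.

Lemma yb_repP n : is_yb_rep R (yb_rep R n).
Proof.
apply: (@xgetPex _ _ [set rho : Sinf -> 'M[C]_(d ^ n) | is_yb_rep R rho]).
exists (fun s => cox (yb_gen R n) n s); split=> [|s t|k hk].
- exact: cox1.
- rewrite !inE => hs ht; apply: coxM hs ht => [k kn|k kn|k l kl ln].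
  + exact: yb_gen_invol.
  + exact: yb_gen_braid.
  + exact: yb_gen_comm.
- apply: cox_gen hk => [l kn|l kn|l m kl ln].
  + exact: yb_gen_invol.
  + exact: yb_gen_braid.
  + exact: yb_gen_comm.
Qed.

Lemma yb_rep_tens n s : sinf_stab n s ->
  mxsim (yb_rep R n s *t I d) (yb_rep R n.+1 s).
Proof.
have [r1 rM rg] := yb_repP n; have [r1' rM' rg'] := yb_repP n.+1.
elim/sinf_stab_ind => [|k t kn ht IH].
  by rewrite r1 r1'; apply/mxsim_sym/mxsim_ids; rewrite expnSr.
have st m : (n <= m)%N -> t \in sinf_stab m.
  by move=> nm; rewrite inE; exact: sinf_stabS ht.
have sk m : (n <= m)%N -> adj k \in sinf_stab m.
  by move=> nm; rewrite inE; apply: sinf_stab_adj; lia.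
rewrite rM ?st ?sk // rM' ?st ?sk // rg // rg'; last lia.
rewrite -[I d]mulmx1 -tensmx_mul.
exact: mxsimM (yb_gen_tens kn) IH.
Qed.

Lemma yb_charE n s : (0 < d)%N -> (0 < n)%N -> sinf_stab n s ->
  yb_char R s = (d%:R ^+ n)^-1 * \tr (yb_rep R n s).
Proof.
move=> d0.
pose f n := (d%:R ^+ n)^-1 * \tr (yb_rep R n s).
have fS m p : sinf_stab m s -> f (m + p)%N = f m.
  move=> hm; elim: p => [|p <-]; first by rewrite addn0.
  rewrite addnS /f -(mxsim_tr (yb_rep_tens _)); last first.
    by apply: sinf_stabS hm; lia.
  rewrite mxtrace_tens mxtrace1 exprSr invfM mulrACA mulVf ?mulr1 // pnatr_eq0; lia.
move=> n0 hn; rewrite /yb_char.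
have := @xgetPex _ 1%N [set n | (0 < n)%N /\ sinf_stab n s] (sinf_stab_ex s).
set m := xget _ _ => /= -[_ hm]; rewrite -/(f m) -/(f n).
by rewrite -(fS m n hm) addnC fS.
Qed.

End YBRep.

Section Characters.
Variable K : realType.
Local Notation C := K[i].
Implicit Types (chi : Sinf -> C) (alpha beta : nat -> K).

Definition positive_definite chi : Prop :=
  forall (n : nat) (s : 'I_n -> Sinf) (z : 'I_n -> C),
    0 <= \sum_(i < n) \sum_(j < n) (z i)^* * z j * chi ((s i)^-1 * s j)%g.

Definition is_character chi : Prop :=
  [/\ positive_definite chi,
      forall s t, chi (s ^ t)%g = chi s &
      chi 1%g = 1].

Definition extremal_character chi : Prop :=
  is_character chi /\
  forall chi1 chi2 (t : K), is_character chi1 -> is_character chi2 ->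
    0 < t < 1 ->
    (forall s, chi s = t%:C%C * chi1 s + (1 - t)%:C%C * chi2 s) ->
    chi1 = chi /\ chi2 = chi.

Definition is_ncycle (n : nat) (s : Sinf) : Prop :=
  exists c : seq nat, [/\ uniq c, size c = n & s =1 next c].

Definition disjoint_supp (s t : Sinf) : Prop :=
  forall i, s i = i \/ t i = i.

Definition thoma_domain alpha beta : Prop :=
  [/\ forall i, 0 <= alpha i.+1 <= alpha i,
      forall i, 0 <= beta i.+1 <= beta i &
      (\sum_(i <oo) (alpha i)%:E + \sum_(i <oo) (beta i)%:E <= 1)%E].

Definition thoma_value alpha beta (n : nat) : K :=
  limn (series (fun i => alpha i ^+ n)) +
  (-1) ^+ n.+1 * limn (series (fun i => beta i ^+ n)).

(* [nat] is 0-based: [alpha i] stands for the parameter usually written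
   alpha_{i+1}. The empty product gives [chi 1 = 1]. *)
Definition thoma_parameters chi alpha beta : Prop :=
  [/\ thoma_domain alpha beta,
      forall n s, (2 <= n)%N -> is_ncycle n s ->
        chi s = (thoma_value alpha beta n)%:C%C &
      forall cs : seq Sinf,
        (forall c, c \in cs -> exists2 n, (2 <= n)%N & is_ncycle n c) ->
        pairwise (fun s t => `[< disjoint_supp s t >]) cs ->
        chi (\prod_(c <- cs) c)%g = \prod_(c <- cs) chi c].

Definition is_yb_character chi : Prop :=
  exists (d : nat) (R : 'M[C]_(d * d)),
    [/\ (0 < d)%N, involutive_Rmatrix R & chi = yb_char R].

End Characters.

(* Main.v *)
(* Let t be the normalised partial trace of R over one factor. Realise the
   transpositions (1 j) on a large tensor power: positivity of the trace of
   (sum_j ((1 j) - t))^2, for more and more j, forces the left and right partial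
   traces to agree, and then R (t (x) 1) = (1 (x) t) R. Tracing out the sites of
   an n-cycle one by one therefore gives chi_R(c_n) = Tr(t^(n-1)) / d.
   Let x be an eigenvalue of t, of multiplicity m. The (anti)symmetrizer of S_N
   commutes with the N-th tensor power of the spectral projection, and the trace
   of their product is prod_(i < N) (m -+ i d x) / N!; being a rank, it is a
   natural number for all N, which forces d |x| to be a positive integer.
   The measure sum alpha_i delta_(alpha_i) + sum beta_j delta_(- beta_j) has the
   same moments (of order >= 1) as the uniform measure on the eigenvalues of t,
   so testing against suitable polynomials locates the Thoma parameters in the
   spectrum of t and shows that they add up to 1.
   Conversely, write alpha_i = a_i / D and beta_j = b_j / D, split C^D into blocks
   of dimensions a_i and b_j, and let R be 1 (resp. -1) on the tensor square of
   a block of the first (resp. second) kind and the flip across blocks. *)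

Require Import Defs.
From HB Require Import structures.
From mathcomp Require Import all_boot all_order all_algebra.
From mathcomp Require Import spectral complex mxtens.
From mathcomp Require Import all_classical all_reals all_analysis.
From mathcomp Require Import zify ring lra.

Set Implicit Arguments.
Unset Strict Implicit.
Unset Printing Implicit Defensive.

Import Order.TTheory GRing.Theory Num.Theory numFieldNormedType.Exports.
Local Open Scope classical_set_scope.
Local Open Scope ring_scope.

(** * Operators on a tensor power *)

(** Write t' for the left partial trace, q = Tr(t^2)/d, q' = Tr(t'^2)/d and c = Tr(t t')/d. Over M
    transpositions the normalised trace of the square is M ((1 - q) + (M - 1)(c - q)), so c >= q;
    reflecting the tensor factors gives c >= q', and then Tr((t - t')^2) <= 0. The cross term is c
    because two transpositions sharing a site multiply to a 3-cycle, in whose trace both partial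
    traces meet. The spectral projections of t inherit covariance because they are polynomials in t.
    The choice between symmetrizer and antisymmetrizer follows the sign of x, so that the factors m
    - i d |x| decrease and the product cannot become negative without first vanishing. Excluding x =
    0 is essential: cycles only give moments of order >= 1, whereas the sum of the Thoma parameters
    is the moment of order 0. Since 0 is not an eigenvalue, a polynomial without constant term can
    equal 1 on the whole spectrum and so measure that sum. Dimensions such as d^k * d * d^(N-k-1)
    and d^N agree only up to a cast, so the computations take place in an abstract ring with a
    trace, of which the tensor power is an instance. *)

Section TensorLinear.
Variable A : comPzRingType.

Lemma tensmx_linearl m n p q (Y : 'M[A]_(p, q)) :
  linear (fun X : 'M[A]_(m, n) => X *t Y).
Proof. by move=> a X X'; apply/matrixP => i j; rewrite !mxE; ring. Qed.

Lemma tensmx_linearr m n p q (X : 'M[A]_(m, n)) :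
  linear (fun Y : 'M[A]_(p, q) => X *t Y).
Proof. by move=> a Y Y'; apply/matrixP => i j; rewrite !mxE; ring. Qed.

Lemma tensmxZl m n p q a (X : 'M[A]_(m, n)) (Y : 'M[A]_(p, q)) :
  (a *: X) *t Y = a *: (X *t Y).
Proof. by apply/matrixP => i j; rewrite !mxE mulrA. Qed.

Lemma tensmx_delta m n (i k : 'I_m) (j l : 'I_n) :
  delta_mx (mxtens_index (i, j)) (mxtens_index (k, l)) =
  (delta_mx i k *t delta_mx j l : 'M[A]_(m * n)).
Proof.
apply/matrixP => x y; case: (mxtens_indexP x) => x1 x2.
case: (mxtens_indexP y) => y1 y2; rewrite tensmxE !mxE.
rewrite !(inj_eq (can_inj (@mxtens_indexK _ _))) !xpair_eqE.
by do 4!case: eqP => _; rewrite /= ?mulr0 ?mul0r ?mulr1.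
Qed.

(* [1 (x) X (x) 1] read as an [n x n] matrix; meaningful when [k * p * l = n]. *)
Definition emb n k p l (X : 'M[A]_p) : 'M[A]_n :=
  conform_mx 1%:M ((1%:M : 'M[A]_k) *t X *t (1%:M : 'M[A]_l)).

Section Emb.
Variables (n k p l : nat) (e : (k * p * l = n)%N).
Local Notation E := (@emb n k p l).

Lemma emb_sim X : mxsim ((1%:M : 'M[A]_k) *t X *t (1%:M : 'M[A]_l)) (E X).
Proof. exact: mxsim_conform. Qed.

Lemma emb_linear : linear E.
Proof.
rewrite /emb.
by case: n / e => a X Y; rewrite !conform_mx_id tensmx_linearr tensmx_linearl.
Qed.

Lemma embZ a X : E (a *: X) = a *: E X.
Proof. exact: (scalable_linear emb_linear). Qed.

Lemma embB X Y : E (X - Y) = E X - E Y.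
Proof. exact: (zmod_morphism_linear emb_linear). Qed.

Lemma embM X Y : E (X *m Y) = E X *m E Y.
Proof.
apply: mxsim_eq; apply: mxsim_trans; first exact: mxsim_sym (emb_sim _).
apply: mxsim_trans; last exact: mxsimM (emb_sim _) (emb_sim _).
by rewrite !tensmx_mul !mulmx1; exact: mxsim_refl.
Qed.

Lemma emb1 : E 1%:M = 1%:M.
Proof. by rewrite /emb !tensmx11; case: n / e; rewrite conform_mx_id. Qed.

Lemma tr_emb X : \tr (E X) = (k * l)%:R * \tr X.
Proof.
rewrite -(mxsim_tr (emb_sim X)) !mxtrace_tens !mxtrace1 natrM; ring.
Qed.

End Emb.
End TensorLinear.

(** For i != j the matrix unit E_ij is E_ii E_ij, while E_ij E_ii = 0, so [f] kills it; and E_ii,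
    E_jj are the two products of E_ij and E_ji, so [f] agrees on them. *)
Lemma tracial_functional (F : fieldType) d (f : 'M[F]_d -> F) :
    d%:R != 0 :> F -> linear_for *%R f -> (forall a b, f (a *m b) = f (b *m a)) ->
  forall a, f a = f 1%:M * (\tr a / d%:R).
Proof.
move=> d0 fl fC.
have fD x y : f (x + y) = f x + f y by rewrite -[x]scale1r fl mul1r scale1r.
have f0 : f 0 = 0 by apply: (addIr (f 0)); rewrite add0r -fD addr0.
have fZ c x : f (c *: x) = c * f x by rewrite -[c *: x]addr0 fl f0 addr0.
have fsum I (s : seq I) (F' : I -> 'M[F]_d) :
    f (\sum_(i <- s) F' i) = \sum_(i <- s) f (F' i) by exact: (big_morph f fD f0).
have fij i j : i != j -> f (delta_mx i j) = 0.
  by move=> ij; rewrite -(mul_delta_mx i) fC mul_delta_mx_cond eq_sym (negbTE ij).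
have fii i j : f (delta_mx i i) = f (delta_mx j j).
  by rewrite -(mul_delta_mx j) fC mul_delta_mx.
have fE i a : f a = f (delta_mx i i) * \tr a.
  rewrite [in LHS](matrix_sum_delta a) fsum mulr_sumr; apply: eq_bigr => j _.
  rewrite fsum (bigD1 j) //= big1 ?addr0 => [|k kj].
    by rewrite fZ (fii j i) mulrC.
  by rewrite fZ fij ?mulr0 // eq_sym.
have dp : (0 < d)%N by rewrite lt0n; apply: contraNneq d0 => ->.
move=> a; rewrite (fE (Ordinal dp)) (fE (Ordinal dp) 1%:M) mxtrace1.
by rewrite -mulrA; congr (_ * _); rewrite mulrC divfK.
Qed.

(** A matrix unit of the product is a tensor of matrix units. Additivity suffices because each
    coefficient is absorbed into the first tensor factor. *)
Lemma tensor_ext (F : comPzRingType) (V : zmodType) m n (f g : 'M[F]_(m * n) -> V) :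
    zmod_morphism f -> zmod_morphism g ->
    (forall (a : 'M[F]_m) (b : 'M[F]_n), f (a *t b) = g (a *t b)) ->
  f =1 g.
Proof.
move=> fB gB fg.
have sum h I (s : seq I) (F' : I -> 'M[F]_(m * n)) : zmod_morphism h ->
    h (\sum_(i <- s) F' i) = \sum_(i <- s) h (F' i) :> V.
  move=> hB; have h0 : h 0 = 0 by rewrite -(subrr 0) hB subrr.
  have hN x : h (- x) = - h x by rewrite -sub0r hB h0 sub0r.
  have hD x y : h (x + y) = h x + h y by rewrite -[y]opprK hB hN !opprK.
  exact: (big_morph h hD h0).
move=> R; rewrite [R]matrix_sum_delta !sum //; apply: eq_bigr => p _.
rewrite !sum //; apply: eq_bigr => q _.
rewrite -[p in delta_mx p]mxtens_unindexK -[q in delta_mx _ q]mxtens_unindexK.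
case: (mxtens_unindex p) => p1 p2; case: (mxtens_unindex q) => q1 q2.
by rewrite tensmx_delta -tensmxZl fg.
Qed.

(* [R] after normalised partial trace over its second, resp. first, factor. *)
Section PartialTrace.
Variables (F : fieldType) (d : nat).
Implicit Types (a b : 'M[F]_d) (R : 'M[F]_(d * d)).

Definition ptr_r R : 'M[F]_d :=
  \matrix_(i, j) (d%:R^-1 * \sum_k R (mxtens_index (i, k)) (mxtens_index (j, k))).
Definition ptr_l R : 'M[F]_d :=
  \matrix_(i, j) (d%:R^-1 * \sum_k R (mxtens_index (k, i)) (mxtens_index (k, j))).

Lemma ptr_rB : zmod_morphism ptr_r.
Proof.
move=> X Y; apply/matrixP => i j; rewrite !mxE -mulrBr; congr (_ * _).
by rewrite -sumrB; apply: eq_bigr => k _; rewrite !mxE.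
Qed.

Lemma ptr_lB : zmod_morphism ptr_l.
Proof.
move=> X Y; apply/matrixP => i j; rewrite !mxE -mulrBr; congr (_ * _).
by rewrite -sumrB; apply: eq_bigr => k _; rewrite !mxE.
Qed.

Lemma ptr_r_tens a b : ptr_r (a *t b) = (\tr b / d%:R) *: a.
Proof.
apply/matrixP => i j; rewrite !mxE mulrAC [RHS]mulrC.
under eq_bigr do rewrite tensmxE.
by rewrite -mulr_sumr -/(mxtrace b); ring.
Qed.

Lemma ptr_l_tens a b : ptr_l (a *t b) = (\tr a / d%:R) *: b.
Proof.
apply/matrixP => i j; rewrite !mxE mulrAC [RHS]mulrC.
under eq_bigr do rewrite tensmxE.
by rewrite -mulr_suml -/(mxtrace a); ring.
Qed.

End PartialTrace.

(* What is used of End(V^{(x) N}): the normalised trace [tau], the operators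
   [site k a] acting by [a] on the k-th factor and the operators [gen k X]
   acting by [X] on the factors k and k+1. *)
Record site_model (F : fieldType) (d N : nat) (A : pzRingType) (tau : A -> F)
    (site : nat -> 'M[F]_d -> A) (gen : nat -> 'M[F]_(d * d) -> A) : Prop := SiteModel {
  sm_dim : d%:R != 0 :> F;
  sm_tauC : forall X Y, tau (X * Y) = tau (Y * X);
  sm_tauB : zmod_morphism tau;
  sm_tau1 : tau 1 = 1;
  sm_tauZ : forall k X c a, (k < N)%N -> tau (X * site k (c *: a)) = c * tau (X * site k a);
  sm_siteM : forall k a b, (k < N)%N -> site k (a *m b) = site k a * site k b;
  sm_site1 : forall k, (k < N)%N -> site k 1%:M = 1;
  sm_siteB : forall k, (k < N)%N -> zmod_morphism (site k);
  sm_siteC : forall k l a b, (k < N)%N -> (l < N)%N -> k != l ->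
    site k a * site l b = site l b * site k a;
  sm_genB : forall k, (k.+1 < N)%N -> zmod_morphism (gen k);
  sm_genM : forall k X Y, (k.+1 < N)%N -> gen k (X *m Y) = gen k X * gen k Y;
  sm_gen_tens : forall k a b, (k.+1 < N)%N -> gen k (a *t b) = site k a * site k.+1 b }.

Section SiteModel.
Variables (F : fieldType) (d N : nat) (A : pzRingType) (tau : A -> F)
  (site : nat -> 'M[F]_d -> A) (gen : nat -> 'M[F]_(d * d) -> A).
Hypothesis sm : site_model N tau site gen.
Implicit Types (a b : 'M[F]_d) (X Y : A) (k l : nat) (R : 'M[F]_(d * d)).

Let tauC := sm_tauC sm.
Let siteM := sm_siteM sm.
Let siteC := sm_siteC sm.

Lemma tau0 : tau 0 = 0.
Proof. by rewrite -(subrr 0) (sm_tauB sm) subrr. Qed.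

Lemma tauN X : tau (- X) = - tau X.
Proof. by rewrite -sub0r (sm_tauB sm) tau0 sub0r. Qed.

Lemma tauD X Y : tau (X + Y) = tau X + tau Y.
Proof. by rewrite -[Y]opprK (sm_tauB sm) tauN !opprK. Qed.

Lemma site0 k : (k < N)%N -> site k 0 = 0.
Proof. by move=> kN; rewrite -(subrr 0) (sm_siteB sm) // subrr. Qed.

Lemma siteD k a b : (k < N)%N -> site k (a + b) = site k a + site k b.
Proof.
move=> kN; have sB := sm_siteB sm kN.
have sN c : site k (- c) = - site k c by rewrite -sub0r sB site0 // sub0r.
by rewrite -[b]opprK sB sN !opprK.
Qed.

(** Being in the commutant of the k-th factor stands for acting trivially on that factor, without
    exhibiting a tensor decomposition of [X]. *)
Definition commutes_site k X := forall a, X * site k a = site k a * X.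

Lemma commutes_site1 k : commutes_site k 1.
Proof. by move=> a; rewrite mulr1 mul1r. Qed.

Lemma commutes_siteM k X Y :
  commutes_site k X -> commutes_site k Y -> commutes_site k (X * Y).
Proof. by move=> hX hY a; rewrite -mulrA hY mulrA hX mulrA. Qed.

Lemma commutes_site_prod k (I : eqType) (s : seq I) (G : I -> A) :
  (forall i, i \in s -> commutes_site k (G i)) ->
  commutes_site k (\prod_(i <- s) G i).
Proof.
move=> hG; rewrite big_seq; apply: big_ind => //; last exact: commutes_siteM.
exact: commutes_site1.
Qed.

Lemma commutes_site_site k l a : (k < N)%N -> (l < N)%N -> l != k ->
  commutes_site k (site l a).
Proof. by move=> kN lN kl b; apply: siteC. Qed.

Lemma commutes_site_gen R k l : (k < N)%N -> (l.+1 < N)%N ->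
  l != k -> l.+1 != k -> commutes_site k (gen l R).
Proof.
move=> kN lN lk l1k a; apply: (tensor_ext
  (f := fun R => gen l R * site k a) (g := fun R => site k a * gen l R)).
- by move=> X Y; rewrite (sm_genB sm) // mulrBl.
- by move=> X Y; rewrite (sm_genB sm) // mulrBr.
- move=> b c; rewrite (sm_gen_tens sm) //.
  by apply: commutes_siteM; apply: commutes_site_site => //; lia.
Qed.

(** As [X] commutes with the k-th factor, b |-> tau (X * site k b) is tracial, hence a multiple of
    the matrix trace. *)
Lemma tau_site_mul k X a : (k < N)%N -> commutes_site k X ->
  tau (X * site k a) = tau X * (\tr a / d%:R).
Proof.
move=> kN hX; pose f b := tau (X * site k b).
have fl : linear_for *%R f.
  by move=> c x y; rewrite /f siteD // mulrDr tauD (sm_tauZ sm).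
have fC x y : f (x *m y) = f (y *m x).
  rewrite /f !siteM // mulrA hX -mulrA tauC -mulrA //.
have := tracial_functional (sm_dim sm) fl fC a.
by rewrite /f (sm_site1 sm) // mulr1.
Qed.

Lemma tau_site k a : (k < N)%N -> tau (site k a) = \tr a / d%:R.
Proof.
move=> kN; rewrite -[site k a]mul1r tau_site_mul ?(sm_tau1 sm) ?mul1r //.
exact: commutes_site1.
Qed.

(** Both sides are additive in [R], and for R = a (x) b the factor b is alone on site k+1 and traces
    out. So [ptr_r] is the conditional expectation that forgets site k+1. *)
Lemma tau_gen_r R k X : (k.+1 < N)%N -> commutes_site k.+1 X ->
  tau (X * gen k R) = tau (X * site k (ptr_r R)).
Proof.
move=> kN hX; have kN' : (k < N)%N by exact: ltnW.
apply: (tensor_ext (f := fun R => tau (X * gen k R))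
    (g := fun R => tau (X * site k (ptr_r R)))) R.
- by move=> Y Z; rewrite (sm_genB sm) // mulrBr (sm_tauB sm).
- by move=> Y Z; rewrite ptr_rB (sm_siteB sm) // mulrBr (sm_tauB sm).
move=> a b; rewrite (sm_gen_tens sm) // ptr_r_tens (sm_tauZ sm) // mulrA.
rewrite [RHS]mulrC; apply: tau_site_mul; first lia.
by apply: commutes_siteM => //; apply: commutes_site_site => //; lia.
Qed.

Lemma tau_gen_l R k X : (k.+1 < N)%N -> commutes_site k X ->
  tau (X * gen k R) = tau (X * site k.+1 (ptr_l R)).
Proof.
move=> kN hX; have kN' : (k < N)%N by exact: ltnW.
apply: (tensor_ext (f := fun R => tau (X * gen k R))
    (g := fun R => tau (X * site k.+1 (ptr_l R)))) R.
- by move=> Y Z; rewrite (sm_genB sm) // mulrBr (sm_tauB sm).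
- by move=> Y Z; rewrite ptr_lB (sm_siteB sm) // mulrBr (sm_tauB sm).
move=> a b; rewrite (sm_gen_tens sm) // ptr_l_tens (sm_tauZ sm) //.
rewrite siteC ?mulrA; [|lia..].
rewrite [RHS]mulrC; apply: tau_site_mul; first lia.
by apply: commutes_siteM => //; apply: commutes_site_site => //; lia.
Qed.

Lemma genC R k l : (k.+1 < l)%N -> (l.+1 < N)%N ->
  gen k R * gen l R = gen l R * gen k R.
Proof.
move=> kl lN.
suff E : (fun Z => gen k R * gen l Z) =1 (fun Z => gen l Z * gen k R) by exact: E.
apply: tensor_ext.
- by move=> Y Z; rewrite (sm_genB sm) // mulrBr.
- by move=> Y Z; rewrite (sm_genB sm) // mulrBl.
move=> a b; rewrite (sm_gen_tens sm) // mulrA commutes_site_gen; [|lia..].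
by rewrite -mulrA commutes_site_gen ?mulrA //; lia.
Qed.

Lemma gen1 k : (k.+1 < N)%N -> gen k 1%:M = 1.
Proof.
by move=> kN; rewrite -tensmx11 (sm_gen_tens sm) // !(sm_site1 sm) ?mulr1 //; exact: ltnW.
Qed.

End SiteModel.

Section TensorPower.
Variables (K : realType) (d N : nat).
Hypothesis d_gt0 : (0 < d)%N.
Local Notation C := K[i].
Local Notation A := 'M[C]_(d ^ N).
Implicit Types (a b : 'M[C]_d) (k l : nat).

Definition tpow_site k a : A := emb (d ^ N) (d ^ k) (d ^ (N - k - 1)) a.
Definition tpow_tau (X : A) : C := (d%:R ^+ N)^-1 * \tr X.

Local Notation site := tpow_site.
Local Notation tau := tpow_tau.

Lemma site_dim k : (k < N)%N -> (d ^ k * d * d ^ (N - k - 1) = d ^ N)%N.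
Proof. by move=> kN; rewrite -expnSr -expnD; congr (_ ^ _)%N; lia. Qed.

Lemma gen_dim k : (k.+1 < N)%N -> (d ^ k * (d * d) * d ^ (N - k - 2) = d ^ N)%N.
Proof. by move=> kN; rewrite mulnn -!expnD; congr (_ ^ _)%N; lia. Qed.

Lemma site_sim k a : (k < N)%N ->
  mxsim ((1%:M : 'M[C]_(d ^ k)) *t a *t (1%:M : 'M[C]_(d ^ (N - k - 1)))) (site k a).
Proof. by move=> kN; apply: emb_sim (site_dim kN) _. Qed.

Lemma tpow_siteC_lt k l a b : (k < l)%N -> (l < N)%N ->
  site k a *m site l b = site l b *m site k a.
Proof.
move=> kl lN.
pose P := (1%:M : 'M[C]_(d ^ k)) *t a *t (1%:M : 'M[C]_(d ^ (l - k - 1))).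
pose Q := b *t (1%:M : 'M[C]_(d ^ (N - l - 1))).
have h1 : mxsim (site k a) (P *t (1%:M : 'M[C]_(d * d ^ (N - l - 1)))).
  apply: mxsim_trans; first by apply: mxsim_sym; apply: site_sim; lia.
  apply: mxsim_trans; last exact: mxsim_tensA.
  apply: mxsim_tens; first exact: mxsim_refl.
  by apply: mxsim_ids; rewrite -?expnS -!expnD; congr (_ ^ _)%N; lia.
have h2 : mxsim (site l b) ((1%:M : 'M[C]_(d ^ k * d * d ^ (l - k - 1))) *t Q).
  apply: mxsim_trans; first by apply: mxsim_sym; apply: site_sim; lia.
  apply: mxsim_trans; first exact: mxsim_sym (mxsim_tensA _ _ _).
  apply: mxsim_tens; last exact: mxsim_refl.
  by apply: mxsim_1; rewrite -?expnSr -!expnD; congr (_ ^ _)%N; lia.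
apply: mxsim_eq; apply: mxsim_trans; first exact: mxsimM h1 h2.
apply: mxsim_sym; apply: mxsim_trans; first exact: mxsimM h2 h1.
by rewrite !tensmx_mul !mulmx1 !mul1mx; exact: mxsim_refl.
Qed.

Lemma yb_gen_tensmx k a b : (k.+1 < N)%N ->
  yb_gen (a *t b) N k = site k a *m site k.+1 b.
Proof.
move=> kN.
have h1 : mxsim (site k a) ((1%:M : 'M[C]_(d ^ k)) *t (a *t (1%:M : 'M[C]_d)) *t
    (1%:M : 'M[C]_(d ^ (N - k - 2)))).
  apply: mxsim_trans; first by apply: mxsim_sym; apply: site_sim; lia.
  apply: mxsim_trans; last exact: mxsim_tens (mxsim_sym (mxsim_tensA _ _ _)) (mxsim_refl _).
  apply: mxsim_trans; last exact: mxsim_tensA.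
  apply: mxsim_tens; first exact: mxsim_refl.
  by apply: mxsim_ids; rewrite -?expnS; congr (_ ^ _)%N; lia.
have h2 : mxsim (site k.+1 b) ((1%:M : 'M[C]_(d ^ k)) *t ((1%:M : 'M[C]_d) *t b) *t
    (1%:M : 'M[C]_(d ^ (N - k - 2)))).
  apply: mxsim_trans; first by apply: mxsim_sym; apply: site_sim; lia.
  apply: mxsim_tens; last by apply: mxsim_1; congr (_ ^ _)%N; lia.
  apply: mxsim_trans; last exact: mxsim_sym (mxsim_tensA _ _ _).
  apply: mxsim_tens; last exact: mxsim_refl.
  by apply: mxsim_ids; rewrite expnSr.
apply: mxsim_eq; apply: mxsim_trans; first exact: mxsim_sym (yb_gen_sim _ kN).
apply: mxsim_sym; apply: mxsim_trans; first exact: mxsimM h1 h2.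
by rewrite !tensmx_mul !mulmx1 mul1mx; exact: mxsim_refl.
Qed.

(** Casts between dimensions are confined to this instance. *)
Lemma tpow_model : site_model N tau site (fun k X => yb_gen X N k).
Proof.
have d0 : d%:R != 0 :> C by rewrite pnatr_eq0 -lt0n.
split.
- exact: d0.
- by move=> X Y; rewrite /tpow_tau; congr (_ * _); exact: mxtrace_mulC.
- by move=> X Y; rewrite /tpow_tau raddfB mulrBr.
- by rewrite /tpow_tau mxtrace1 natrX mulVf // expf_neq0.
- move=> k X c a kN; rewrite /tpow_site (embZ (site_dim kN)) -mulmxE -scalemxAr.
  by rewrite /tpow_tau mxtraceZ mulrCA.
- by move=> k a b kN; exact: embM (site_dim kN) _ _.
- by move=> k kN; exact: emb1 (site_dim kN).
- by move=> k kN a b; exact: embB (site_dim kN) _ _.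
- move=> k l a b kN lN; case: ltngtP => // kl _; last symmetry.
    exact: tpow_siteC_lt.
  exact: tpow_siteC_lt.
- by move=> k kN X Y; exact: embB (gen_dim kN) _ _.
- by move=> k X Y kN; exact: embM (gen_dim kN) _ _.
- exact: yb_gen_tensmx.
Qed.

End TensorPower.

(** * Partial traces and covariance *)

(* [swap j] plays the role of the transposition exchanging the first site
   with site [j + 1]. *)
Section StarTranspositions.
Variables (F : fieldType) (A : pzRingType) (tau : A -> F) (s : nat -> A) (u : A).
Variables (M : nat) (c q : F).
Hypothesis tauC : forall x y, tau (x * y) = tau (y * x).
Hypothesis tauB : zmod_morphism tau.
Hypothesis tau1 : tau 1 = 1.
Hypothesis s_invol : forall j, (j < M)%N -> s j * s j = 1.
Hypothesis s_braid : forall j, (j.+1 < M)%N ->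
  s j * s j.+1 * s j = s j.+1 * s j * s j.+1.
Hypothesis s_comm : forall i j, (i.+1 < j)%N -> (j < M)%N -> s i * s j = s j * s i.
Hypothesis su_comm : forall j, (0 < j < M)%N -> s j * u = u * s j.
Hypothesis tau_su : (0 < M)%N -> tau (s 0%N * u) = q.
Hypothesis tau_uu : tau (u * u) = q.
Hypothesis tau_ss : (1 < M)%N -> tau (s 0%N * s 1%N) = c.

Fixpoint swap j := if j is i.+1 then s j * swap i * s j else s 0%N.

Lemma swapV i : (i < M)%N -> swap i * swap i = 1.
Proof.
elim: i => [|i IH] iM; first exact: s_invol.
rewrite /= !mulrA -[_ * s i.+1 * s i.+1]mulrA s_invol // mulr1.
by rewrite -[_ * swap i * swap i]mulrA IH ?mulr1 ?s_invol //; lia.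
Qed.

Lemma swap_comm i k : (i.+1 < k)%N -> (k < M)%N -> swap i * s k = s k * swap i.
Proof.
elim: i => [|i IH] ik kM; first exact: s_comm.
rewrite /= -mulrA s_comm // mulrA -[_ * swap i * s k]mulrA IH; [|lia|lia].
by rewrite mulrA s_comm // !mulrA.
Qed.

Lemma swap_braid i : (i.+1 < M)%N ->
  swap i * s i.+1 * swap i = s i.+1 * swap i * s i.+1.
Proof.
elim: i => [|i IH] iM; first exact: s_braid.
rewrite /=; set a := s i.+1; set b := s i.+2; set w := swap i.
have wb : w * b = b * w by apply: swap_comm; lia.
have waw : w * a * w = a * w * a by apply: IH; lia.
have aba : a * b * a = b * a * b by apply: s_braid.
have bb : b * b = 1 by apply: s_invol.
(* The swap of index i+1 is a w a. The chain uses only the braid relations for w, a and for a, b,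
   the commutation of w with b, and b^2 = 1. *)
transitivity (a * w * (a * b * a) * w * a); first by rewrite !mulrA.
rewrite aba; transitivity (a * (w * b) * a * (b * w) * a); first by rewrite !mulrA.
rewrite -wb {1}wb; transitivity (a * b * (w * a * w) * b * a); first by rewrite !mulrA.
rewrite waw; transitivity ((a * b * a) * w * (a * b * a)); first by rewrite !mulrA.
rewrite aba; transitivity (b * a * (b * w) * b * a * b); first by rewrite !mulrA.
rewrite -wb; transitivity (b * a * w * (b * b) * a * b); first by rewrite !mulrA.
by rewrite bb mulr1 !mulrA.
Qed.

Lemma tau_swap_next i : (i.+1 < M)%N -> tau (swap i * s i.+1) = c.
Proof.
elim: i => [|i IH] iM; first exact: tau_ss.
rewrite /=; set a := s i.+1; set b := s i.+2; set w := swap i.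
have wb : w * b = b * w by apply: swap_comm; lia.
have aba : a * b * a = b * a * b by apply: s_braid.
have bb : b * b = 1 by apply: s_invol.
transitivity (tau (a * (w * (a * b)))); first by rewrite !mulrA.
rewrite tauC; transitivity (tau (w * (a * b * a))); first by rewrite !mulrA.
rewrite aba; transitivity (tau (b * (w * (a * b)))); first by rewrite !mulrA wb.
rewrite tauC; transitivity (tau (w * a * (b * b))); first by rewrite !mulrA.
by rewrite bb mulr1; apply: IH; lia.
Qed.

(** Such a product is a 3-cycle, and all of them are conjugate to s_0 s_1: conjugation lowers j down
    to i+1, where the braid relation reduces to [tau_swap_next]. *)
Lemma tau_swap2 i j : (i < j)%N -> (j < M)%N -> tau (swap i * swap j) = c.
Proof.
elim: j => // j IH; rewrite ltnS leq_eqVlt => /predU1P[->|ij] jM.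
  rewrite /=; set b := s j.+1; set w := swap j.
  have wbw : w * b * w = b * w * b by apply: swap_braid.
  have ww : w * w = 1 by apply: swapV; lia.
  rewrite -wbw !mulrA ww mul1r tauC; exact: tau_swap_next.
rewrite /= !mulrA swap_comm // -!mulrA tauC !mulrA -[_ * s j.+1 * s j.+1]mulrA.
by rewrite s_invol // mulr1 IH //; lia.
Qed.

Lemma tau_swap_u j : (j < M)%N -> tau (swap j * u) = q.
Proof.
elim: j => [|j IH] jM; first exact: tau_su.
rewrite /= -!mulrA su_comm; last lia.
by rewrite tauC -!mulrA s_invol // mulr1 IH //; lia.
Qed.

Let tau_sum0 : tau 0 = 0.
Proof. by rewrite -(subrr 0) tauB subrr. Qed.

Let tauD x y : tau (x + y) = tau x + tau y.
Proof.
have tauN z : tau (- z) = - tau z by rewrite -sub0r tauB tau_sum0 sub0r.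
by rewrite -[y]opprK tauB tauN !opprK.
Qed.

(** A diagonal term is 1 - 2q + q and an off-diagonal one c - 2q + q; each row has M - 1 of the
    latter. *)
Lemma tau_star_sq :
  tau ((\sum_(j < M) (swap j - u)) * (\sum_(j < M) (swap j - u))) =
  M%:R * ((1 - q) + M.-1%:R * (c - q)).
Proof.
rewrite mulr_suml (big_morph tau tauD tau_sum0).
rewrite (eq_bigr (fun=> (1 - q) + M.-1%:R * (c - q))); last first.
  move=> i _; rewrite mulr_sumr (big_morph tau tauD tau_sum0).
  rewrite (eq_bigr (fun j => if j == i then 1 - q else c - q)); last first.
    move=> j _; rewrite mulrBl !mulrBr !tauB tau_uu tau_swap_u //.
    rewrite [tau (u * _)]tauC tau_swap_u // subrr subr0.
    case: ifP => [/eqP->|/negbT]; first by rewrite swapV ?tau1.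
    rewrite -(inj_eq val_inj) /= neq_ltn => /orP[] ij; last by rewrite tau_swap2.
    by rewrite tauC tau_swap2.
  rewrite (bigD1 i) //= eqxx; congr (_ + _).
  rewrite (eq_bigr (fun=> c - q)) => [|j /negbTE-> //].
  by rewrite sumr_const cardC1 card_ord [RHS]mulr_natl.
by rewrite sumr_const card_ord [RHS]mulr_natl.
Qed.

End StarTranspositions.

Section YangBaxterModel.
Variables (F : fieldType) (d N : nat) (A : pzRingType) (tau : A -> F)
  (site : nat -> 'M[F]_d -> A) (gen : nat -> 'M[F]_(d * d) -> A).
Hypothesis sm : site_model N tau site gen.
Variable R : 'M[F]_(d * d).
Hypothesis R_invol : R *m R = 1%:M.
Hypothesis gen_braid : forall k, (k.+2 < N)%N ->
  gen k R * gen k.+1 R * gen k R = gen k.+1 R * gen k R * gen k.+1 R.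
Local Notation r k := (gen k R).
Local Notation t := (ptr_r R).
Local Notation t' := (ptr_l R).

Lemma gen_invol k : (k.+1 < N)%N -> r k * r k = 1.
Proof. by move=> kN; rewrite -(sm_genM sm) // R_invol (gen1 sm). Qed.

(** Tracing the last site out of r_(k+1) leaves t on the middle site, and tracing the first site out
    of r_k leaves t' there. *)
Lemma tau_gen2 k : (k.+2 < N)%N -> tau (r k * r k.+1) = \tr (t *m t') / d%:R.
Proof.
move=> kN; rewrite (tau_gen_r sm) //; last by apply: (commutes_site_gen sm) => //; lia.
rewrite (sm_tauC sm) (tau_gen_l sm) //; [|lia|]; last first.
  by apply: (commutes_site_site sm) => //; lia.
by rewrite -(sm_siteM sm) ?(tau_site sm) //; lia.
Qed.

Lemma tau_star_r M : N = M.+1 ->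
  let X := \sum_(j < M) (swap (fun k => r k) j - site 0%N t) in
  tau (X * X) = M%:R * ((1 - \tr (t *m t) / d%:R) +
     M.-1%:R * (\tr (t *m t') / d%:R - \tr (t *m t) / d%:R)).
Proof.
move=> NM; apply: tau_star_sq => [||||||j jM|M0||M1].
- exact: sm_tauC sm.
- exact: sm_tauB sm.
- exact: sm_tau1 sm.
- by move=> j jM; apply: gen_invol; lia.
- by move=> j jM; apply: gen_braid; lia.
- by move=> i j ij jM; apply: (genC sm) => //; lia.
- by apply: (commutes_site_gen sm); lia.
- rewrite (sm_tauC sm) (tau_gen_r sm); [|lia|]; last first.
    by apply: (commutes_site_site sm); lia.
  by rewrite -(sm_siteM sm) ?(tau_site sm) //; lia.
- by rewrite -(sm_siteM sm) ?(tau_site sm) //; lia.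
- by apply: tau_gen2; lia.
Qed.

(** The mirror image of [tau_star_r]: with the generators in reverse order the transpositions share
    the last site, where tracing out the other site leaves t'. *)
Lemma tau_star_l M : N = M.+1 ->
  let X := \sum_(j < M) (swap (fun k => r (M.-1 - k)%N) j - site M t') in
  tau (X * X) = M%:R * ((1 - \tr (t' *m t') / d%:R) +
     M.-1%:R * (\tr (t *m t') / d%:R - \tr (t' *m t') / d%:R)).
Proof.
move=> NM; apply: tau_star_sq => [||||||j jM|M0||M1].
- exact: sm_tauC sm.
- exact: sm_tauB sm.
- exact: sm_tau1 sm.
- by move=> j jM; apply: gen_invol; lia.
- move=> j jM; have -> : (M.-1 - j)%N = (M.-1 - j.+1).+1 by lia.
  by rewrite gen_braid //; lia.
- by move=> i j ij jM; symmetry; apply: (genC sm) => //; lia.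
- by apply: (commutes_site_gen sm); lia.
- have -> : site M t' = site (M.-1 - 0).+1 t' by congr site; lia.
  rewrite (sm_tauC sm) (tau_gen_l sm); [|lia|]; last first.
    by apply: (commutes_site_site sm); lia.
  by rewrite -(sm_siteM sm) ?(tau_site sm) //; lia.
- by rewrite -(sm_siteM sm) ?(tau_site sm) //; lia.
- have -> : (M.-1 - 0)%N = (M.-1 - 1).+1 by lia.
  by rewrite (sm_tauC sm); apply: tau_gen2; lia.
Qed.

(** Four sites are needed: the crossing r_1 acts on the two middle ones, and each outer site lets a
    t beside the crossing be written as a generator, r_2 traced over site 3 or r_0 traced over site
    0. The cross term becomes tau (r_1 r_2 r_1 r_0), which the braid relation and cyclicity reduce
    to tau (r_0 r_1). With t = t' all terms of the square then equal Tr(t^2)/d and cancel. *)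
Lemma tau_covariance : N = 4 -> t = t' ->
  let X := r 1%N * site 1%N t * r 1%N - site 2%N t in tau (X * X) = 0.
Proof.
move=> N4 tt'; rewrite /=.
set r1 := r 1%N; set s1 := site 1%N t; set s2 := site 2%N t.
have tauC := sm_tauC sm.
have rr : r1 * r1 = 1 by apply: gen_invol; lia.
have q1 : tau (s1 * s1) = \tr (t *m t) / d%:R.
  by rewrite -(sm_siteM sm) ?(tau_site sm) //; lia.
have q2 : tau (s2 * s2) = \tr (t *m t) / d%:R.
  by rewrite -(sm_siteM sm) ?(tau_site sm) //; lia.
have cross : tau (r1 * s1 * r1 * s2) = \tr (t *m t) / d%:R.
  rewrite -(tau_gen_r sm); [|lia|]; last first.
    apply: commutes_siteM; first apply: commutes_siteM.
    - by apply: (commutes_site_gen sm); lia.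
    - by apply: (commutes_site_site sm); lia.
    - by apply: (commutes_site_gen sm); lia.
  transitivity (tau (r1 * r (1%N.+1) * r1 * site 1%N t')).
    by rewrite -tt' -/s1 [in RHS]tauC -!mulrA [in LHS]tauC -!mulrA.
  rewrite -(tau_gen_l sm); [|lia|]; last first.
    by do 2?apply: commutes_siteM; apply: (commutes_site_gen sm); lia.
  rewrite gen_braid; last lia.
  have rr02 : r 2%N * r 0%N = r 0%N * r 2%N by symmetry; apply: (genC sm); lia.
  rewrite -mulrA rr02.
  rewrite -!mulrA tauC -!mulrA gen_invol ?mulr1; last lia.
  by rewrite tauC tau_gen2 -?tt' //; lia.
have sq : (r1 * s1 * r1) * (r1 * s1 * r1) = r1 * (s1 * s1) * r1.
  by rewrite !mulrA -[_ * r1 * r1]mulrA rr mulr1.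
rewrite mulrBl !mulrBr !(sm_tauB sm) sq [tau (s2 * (_ * _))]tauC cross q2.
by rewrite -mulrA tauC -mulrA rr mulr1 q1 !subrr.
Qed.

(* [a] passes through the crossing: R (a (x) 1) = (1 (x) a) R. *)
Definition covariant a := forall k, (k.+1 < N)%N -> r k * site k a = site k.+1 a * r k.

Lemma covariantV a k : covariant a -> (k.+1 < N)%N -> site k a * r k = r k * site k.+1 a.
Proof.
move=> ca kN; rewrite -[site k a]mul1r -(gen_invol kN) -!mulrA [r k * (site k a * _)]mulrA.
by rewrite ca // -[_ * r k * r k]mulrA gen_invol // mulr1.
Qed.

Lemma covariantM a b : covariant a -> covariant b -> covariant (a *m b).
Proof.
move=> ca cb k kN; rewrite !(sm_siteM sm) //; last exact: ltnW.
by rewrite mulrA ca // -!mulrA cb.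
Qed.

Lemma covariantD a b : covariant a -> covariant b -> covariant (a + b).
Proof.
move=> ca cb k kN; rewrite !(siteD sm) //; last exact: ltnW.
by rewrite mulrDl mulrDr ca // cb.
Qed.

Section Covariance.
Hypothesis t_cov : covariant t.

Lemma prod_gen_cov m i : (m + i < N)%N ->
  (\prod_(m <= k < m + i) r k) * site (m + i) t = site m t * \prod_(m <= k < m + i) r k.
Proof.
elim: i => [|i IH] miN; first by rewrite addn0 big_geq // mulr1 mul1r.
rewrite addnS big_nat_recr ?leq_addr //= -mulrA -covariantV //; last lia.
by rewrite mulrA IH ?mulrA //; lia.
Qed.

(* Tracing out the last site of a cycle turns the crossing into a factor [t]. *)
Lemma tau_cycle m i j X : (m + i < N)%N ->
    (forall k, (m <= k < N)%N -> commutes_site site k X) ->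
  tau (X * site m (iter j (mulmx t) 1%:M) * \prod_(m <= k < m + i) r k) =
  tau X * (\tr (iter (i + j) (mulmx t) 1%:M) / d%:R).
Proof.
elim: i j => [|i IH] j miN hX.
  rewrite addn0 big_geq // mulr1 (tau_site_mul sm) //; first lia.
  by apply: hX; lia.
rewrite addnS big_nat_recr ?leq_addr //= mulrA (tau_gen_r sm); [|lia|]; last first.
  apply: commutes_siteM; first apply: commutes_siteM.
  - by apply: hX; lia.
  - by apply: (commutes_site_site sm); lia.
  - apply: commutes_site_prod => k; rewrite mem_index_iota => hk.
    by apply: (commutes_site_gen sm); lia.
(* Covariance slides the new t from site m+i back to site m, where it joins the power already there;
   this is why the induction is over arbitrary j. *)
rewrite -mulrA prod_gen_cov ?mulrA; last lia.
rewrite -[X * _ * site m t]mulrA -(sm_siteM sm); last lia.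
have -> : iter j (mulmx t) 1%:M *m t = iter j.+1 (mulmx t) 1%:M.
  by elim: j => [|j IHj] /=; [rewrite mul1mx mulmx1 | rewrite -mulmxA IHj].
by rewrite IH ?addnS /= ?mulrA //; lia.
Qed.

End Covariance.
End YangBaxterModel.

(** * Symmetrizers *)

(* With e = -1 (resp. 1), [symm n] is the sum over S_n of the signed
   (resp. unsigned) group elements, factored through the cosets of the chain
   of subgroups S_m: [coset_sum n] sums over representatives of S_n \ S_(n+1). *)
Section Symmetrizer.
Variables (A : pzRingType) (N : nat) (r : nat -> A) (e : A).
Hypothesis eC : forall x, x * e = e * x.
Hypothesis ee : e * e = 1.
Hypothesis r_invol : forall k, (k.+1 < N)%N -> r k * r k = 1.
Hypothesis r_braid : forall k, (k.+2 < N)%N ->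
  r k * r k.+1 * r k = r k.+1 * r k * r k.+1.
Hypothesis r_comm : forall k l, (k.+1 < l)%N -> (l.+1 < N)%N -> r k * r l = r l * r k.

Fixpoint coset_sum n : A := if n is m.+1 then 1 + e * (r m * coset_sum m) else 1.
Fixpoint symm n : A := if n is m.+1 then symm m * coset_sum m else 1.

Let eCA x y : x * (e * y) = e * (x * y).
Proof. by rewrite mulrA eC -mulrA. Qed.

Lemma coset_sum_comm n x : (forall k, (k < n)%N -> r k * x = x * r k) ->
  coset_sum n * x = x * coset_sum n.
Proof.
elim: n => [|n IH] hx; first by rewrite mul1r mulr1.
rewrite /= mulrDl mulrDr mul1r mulr1 eCA -!mulrA IH => [|k kn]; last by apply: hx; lia.
by rewrite [r n * _]mulrA hx ?mulrA.
Qed.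

Lemma symm_comm n x : (forall k, (k.+1 < n)%N -> r k * x = x * r k) ->
  symm n * x = x * symm n.
Proof.
elim: n => [|n IH] hx; first by rewrite mul1r mulr1.
rewrite /= -mulrA coset_sum_comm => [|k kn]; last by apply: hx; lia.
by rewrite mulrA IH ?mulrA // => k kn; apply: hx; lia.
Qed.

(** Right multiplication by [r k] permutes the cosets. The statement allows any [b] absorbing the
    earlier generators, not just [symm n], because the induction replaces b by its product with the
    next generator. *)
Lemma coset_sum_absorb n b k : (n < N)%N -> (k < n)%N ->
    (forall l, (l.+1 < n)%N -> b * r l = e * b) ->
  b * coset_sum n * r k = e * (b * coset_sum n).
Proof.
elim: n b => // n IH b nN; rewrite ltnS leq_eqVlt => /predU1P[->|kn] hb; last first.
  have hb' l : (l.+1 < n)%N -> b * r n * r l = e * (b * r n).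
    by move=> ln; rewrite -mulrA -r_comm // mulrA hb ?mulrA //; lia.
  rewrite /= mulrDr mulrDl mulr1 hb; last lia.
  rewrite mulrDr eCA -2!mulrA; congr (_ + _); congr (e * _).
  have := IH _ (ltnW nN) kn hb'; rewrite -!mulrA => ->.
  by rewrite !mulrA.
case: n nN hb {IH} => [|n] nN hb.
  rewrite /= !mulr1 mulrDr mulrDl mulr1 mulrDr eCA -!mulrA r_invol // mulr1.
  by rewrite [e * (e * _)]mulrA ee mul1r addrC.
have cr : coset_sum n * r n.+1 = r n.+1 * coset_sum n.
  by apply: coset_sum_comm => l ln; apply: r_comm; lia.
(* Here the coset sum is 1 + e a + a c x. Multiplying by a on the right exchanges the first two
   terms up to e; the third becomes a c a x = c a c x, whose leading c is absorbed by b. *)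
set a := r n.+1 in cr *; set c := r n; set x := coset_sum n in cr *.
have aca : a * c * a = c * a * c by rewrite [RHS]r_braid.
have aa : a * a = 1 by apply: r_invol.
have bc : b * c = e * b by apply: hb; lia.
rewrite /= -/a -/c -/x.
have lhs : e * (a * (1 + e * (c * x))) * a = e + c * a * c * x.
  rewrite mulrDr mulr1 eCA mulrDr mulrDl -[e * a * a]mulrA aa mulr1; congr (_ + _).
  rewrite mulrA ee mul1r -!mulrA cr.
  by rewrite !mulrA aca.
rewrite mulrDr mulr1 mulrDl -[b * _ * a]mulrA lhs !mulrDr.
rewrite [b * (c * a * c * x)]mulrA [b * (c * a * c)]mulrA [b * (c * a)]mulrA bc.
rewrite !addrA; congr (_ + _); last first.
  by rewrite !eCA [e * (e * _)]mulrA ee mul1r !mulrA.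
by rewrite mulr1 eCA [e * (e * _)]mulrA ee mul1r eC addrC.
Qed.

Lemma symm_absorb n k : (n <= N)%N -> (k.+1 < n)%N -> symm n * r k = e * symm n.
Proof.
elim: n k => // n IH k nN kn; apply: coset_sum_absorb => // l ln.
by apply: IH => //; exact: ltnW.
Qed.

Lemma symm_coset_sum n k : (n <= N)%N -> (k < n)%N ->
  symm n * coset_sum k = symm n *+ k.+1.
Proof.
move=> nN; elim: k => [|k IH] kn; first by rewrite mulr1.
rewrite /= mulrDr mulr1 eCA [symm n * (_ * _)]mulrA symm_absorb // -mulrA mulrA ee.
by rewrite mul1r IH ?mulrS // ltnW.
Qed.

(** For m = n this makes symm n / n! idempotent whenever n! is invertible. *)
Lemma symm_symm n m : (n <= N)%N -> (m <= n)%N -> symm n * symm m = symm n *+ m`!.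
Proof.
move=> nN; elim: m => [|m IH] mn; first by rewrite mulr1.
by rewrite /= mulrA IH ?(ltnW mn) // mulrnAl symm_coset_sum // -mulrnA -factS.
Qed.

End Symmetrizer.

Section SymmetrizerTrace.
Variables (F : fieldType) (d N : nat) (A : pzRingType) (tau : A -> F)
  (site : nat -> 'M[F]_d -> A) (gen : nat -> 'M[F]_(d * d) -> A).
Hypothesis sm : site_model N tau site gen.
Variable R : 'M[F]_(d * d).
Hypothesis R_invol : R *m R = 1%:M.
Hypothesis gen_braid : forall k, (k.+2 < N)%N ->
  gen k R * gen k.+1 R * gen k R = gen k.+1 R * gen k R * gen k.+1 R.
Local Notation r := (fun k => gen k R).
Local Notation t := (ptr_r R).
Variables (P : 'M[F]_d) (lam : F) (sgn : nat).
Hypothesis P_cov : covariant N site gen R P.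
Hypothesis PP : P *m P = P.
Hypothesis Pt : P *m t = lam *: P.
Local Notation e := ((-1) ^+ sgn).
Local Notation symm := (symm r e).
Local Notation coset_sum := (coset_sum r e).

Definition site_prod n : A := \prod_(0 <= i < n) site i P.

Let site_prodS n : site_prod n.+1 = site_prod n * site n P.
Proof. by rewrite /site_prod big_nat_recr. Qed.

Let tauC := sm_tauC sm.

Let signC (x : A) : x * e = e * x.
Proof. by rewrite -signr_odd; case: odd; rewrite ?mulrN1 ?mulN1r ?mulr1 ?mul1r. Qed.

Let sign2 : e * e = 1 :> A.
Proof. by rewrite -exprD addnn -signr_odd odd_double. Qed.

Let tau_sign (x : A) : tau (e * x) = e * tau x.
Proof. by rewrite -signr_odd -[in RHS]signr_odd; case: odd; rewrite ?mulN1r ?mul1r ?(tauN sm). Qed.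

Lemma site_prod_comm n k : (k.+1 < n)%N -> (n <= N)%N ->
  r k * site_prod n = site_prod n * r k.
Proof.
elim: n => // n IH; rewrite ltnS leq_eqVlt => /predU1P[<-|kn] nN; last first.
  rewrite site_prodS mulrA IH //; last exact: ltnW.
  by rewrite -!mulrA (commutes_site_gen sm) //; lia.
rewrite !site_prodS; set Q := site_prod k.
have rQ : r k * Q = Q * r k.
  rewrite /Q /site_prod big_seq; apply: (big_rec (fun x => r k * x = x * r k)).
    by rewrite mulr1 mul1r.
  move=> i x; rewrite mem_index_iota => hi hx.
  by rewrite mulrA (commutes_site_gen sm) -?mulrA ?hx; [|lia..].
rewrite !mulrA rQ -!mulrA; congr (_ * _).
rewrite mulrA P_cov // -mulrA -(covariantV sm R_invol P_cov) // !mulrA.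
by rewrite (sm_siteC sm) //; lia.
Qed.

Lemma site_prodC n l : (n <= l)%N -> (l < N)%N ->
  commutes_site site l (site_prod n).
Proof.
move=> nl lN; apply: commutes_site_prod => i; rewrite mem_index_iota => hi.
by apply: (commutes_site_site sm); lia.
Qed.

Lemma site_prod_absorb n : (n < N)%N -> site n P * site_prod n.+1 = site_prod n.+1.
Proof.
move=> nN; rewrite site_prodS mulrA -site_prodC // -mulrA -(sm_siteM sm) ?PP //.
Qed.

Lemma site_prod_sq n : (n <= N)%N -> site_prod n * site_prod n = site_prod n.
Proof.
elim: n => [|n IH] nN; first by rewrite /site_prod big_geq // mulr1.
rewrite {1}site_prodS -mulrA site_prod_absorb // {1}site_prodS.
by rewrite mulrA IH ?(ltnW nN) // -site_prodS.
Qed.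

Let r_invol k : (k.+1 < N)%N -> r k * r k = 1.
Proof. by move=> kN; exact: (gen_invol sm R_invol kN). Qed.

Let r_comm k l : (k.+1 < l)%N -> (l.+1 < N)%N -> r k * r l = r l * r k.
Proof. by move=> kl lN; exact: (genC sm). Qed.

Let tauMn x m : tau (x *+ m) = m%:R * tau x.
Proof.
elim: m => [|m IH]; first by rewrite mulr0n (tau0 sm) mul0r.
by rewrite mulrS (tauD sm) IH mulrS mulrDl mul1r.
Qed.

(** Split the last coset sum. The term 1 leaves [P] alone on the new site and gives Tr P / d. In the
    rest the new site can be met by a single generator; tracing it out leaves t next to P, hence
    [lam], and the remaining coset sum is absorbed by the symmetrizer with factor n. *)
Lemma tau_site_prod_symmS n : (n < N)%N ->
  tau (site_prod n.+1 * symm n.+1) =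
  (\tr P / d%:R + e * (n%:R * lam)) * tau (site_prod n * symm n).
Proof.
move=> nN; have symm_site a l : (n <= l)%N -> (l < N)%N ->
    symm n * site l a = site l a * symm n.
  by move=> nl lN; apply: symm_comm => // k kn; rewrite (commutes_site_gen sm) //; lia.
have first_term : tau (site_prod n.+1 * symm n) =
    \tr P / d%:R * tau (site_prod n * symm n).
  rewrite site_prodS -mulrA -symm_site // mulrA [RHS]mulrC; apply: (tau_site_mul sm) => //.
  by apply: commutes_siteM; [exact: site_prodC | move=> a; exact: symm_site].
case: n nN symm_site first_term => [|n] nN symm_site first_term.
  by rewrite mul0r mulr0 addr0 -first_term [symm 1]mulr1.
set X := coset_sum n; set Q := site_prod n.+1; set B := symm n.+1.
have XS : X * site n.+1 P = site n.+1 P * X.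
  by apply: coset_sum_comm => // k kn; rewrite (commutes_site_gen sm) //; lia.
have XQ : X * Q = Q * X.
  by apply: coset_sum_comm => // k kn; apply: site_prod_comm; lia.
have QS : Q * site n.+1 P = site n.+1 P * Q by apply: site_prodC.
have second_term : tau (site_prod n.+2 * (B * (r n * X))) =
    n.+1%:R * lam * tau (Q * B).
  have BS a l : (n < l)%N -> (l < N)%N -> B * site l a = site l a * B by exact: symm_site.
  have BX : B * X = B *+ n.+1.
    by apply: (symm_coset_sum signC sign2 r_invol gen_braid r_comm) => //; exact: ltnW.
  clear symm_site first_term; clearbody B.
  rewrite site_prodS -/Q tauC.
  (* Covariance moves the last [P] from site n+1 to site n, so that [r n] is the only operator left
     on site n+1. *)
  transitivity (tau (X * Q * B * site n P * r n)).
    rewrite QS -!mulrA [X * (_ * _)]mulrA XS -[_ * X * Q]mulrA [r n * _]mulrA.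
    by rewrite -(covariantV sm R_invol P_cov) // [B * _]mulrA tauC !mulrA.
  rewrite (tau_gen_r sm) //; last first.
    apply: commutes_siteM; last by apply: (commutes_site_site sm); lia.
    apply: commutes_siteM; last by move=> a; apply: BS; lia.
    apply: commutes_siteM; last by apply: site_prodC; lia.
    by move=> a; apply: coset_sum_comm => // k kn; rewrite (commutes_site_gen sm) //; lia.
  rewrite -[_ * site n P * _]mulrA -(sm_siteM sm) ?Pt; last exact: ltnW.
  rewrite (sm_tauZ sm) ?(ltnW nN) // [_%:R * lam]mulrC -[lam * _ * _]mulrA; congr (_ * _).
  rewrite XQ tauC !mulrA site_prod_absorb; last exact: ltnW.
  by rewrite -/Q -XQ -mulrA tauC -mulrA BX mulrnAr tauMn.
have -> : symm n.+2 = B * (1 + e * (r n * X)) by [].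
rewrite -/B in first_term; clearbody B X.
rewrite mulrDr mulr1 [B * (e * _)]mulrA signC -[e * B * _]mulrA.
rewrite mulrDr (tauD sm) first_term [_ * (e * _)]mulrA signC -[e * _ * _]mulrA.
by rewrite tau_sign second_term mulrDl; congr (_ + _); rewrite !mulrA.
Qed.

Lemma tau_site_prod_symm n : (n <= N)%N ->
  tau (site_prod n * symm n) = \prod_(i < n) (\tr P / d%:R + e * (i%:R * lam)).
Proof.
elim: n => [|n IH] nN.
  by rewrite big_ord0 /site_prod big_geq // mulr1 (sm_tau1 sm).
by rewrite big_ord_recr /= tau_site_prod_symmS // IH 1?mulrC // ltnW.
Qed.

Lemma site_prod_symm_sq :
  (site_prod N * symm N) * (site_prod N * symm N) = (site_prod N * symm N) *+ N`!.
Proof.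
have -> : site_prod N * symm N = symm N * site_prod N.
  by symmetry; apply: symm_comm => // k kN; apply: site_prod_comm.
rewrite -mulrA [site_prod N * _]mulrA.
have <- : symm N * site_prod N = site_prod N * symm N.
  by apply: symm_comm => // k kN; apply: site_prod_comm.
rewrite -[symm N * site_prod N * _]mulrA site_prod_sq // mulrA.
by rewrite (symm_symm signC sign2 r_invol gen_braid r_comm) // mulrnAl.
Qed.

End SymmetrizerTrace.

(** * Equality of the two partial traces *)

Section Dagger.
Variable C : numClosedFieldType.

Definition dagger m n (X : 'M[C]_(m, n)) : 'M[C]_(n, m) := map_mx Num.conj X^T.
Definition selfadjoint n (X : 'M[C]_n) := dagger X = X.

Lemma daggerE m n (X : 'M[C]_(m, n)) i j : dagger X i j = (X j i)^*.
Proof. by rewrite !mxE. Qed.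

Lemma selfadjointE n (X : 'M[C]_n) i j : selfadjoint X -> (X j i)^* = X i j.
Proof. by move=> hX; rewrite -daggerE hX. Qed.

Lemma daggerM m n p (X : 'M[C]_(m, n)) (Y : 'M[C]_(n, p)) :
  dagger (X *m Y) = dagger Y *m dagger X.
Proof. by rewrite /dagger trmx_mul map_mxM. Qed.

Lemma daggerB m n (X Y : 'M[C]_(m, n)) : dagger (X - Y) = dagger X - dagger Y.
Proof. by rewrite /dagger linearB map_mxB. Qed.

Lemma dagger_emb n k p l (X : 'M[C]_p) : (k * p * l = n)%N ->
  dagger (emb n k l X) = emb n k l (dagger X).
Proof.
move=> e; rewrite /emb; case: n / e; rewrite !conform_mx_id /dagger.
by rewrite !trmx_tens !map_mxT !trmx1 !map_mx1.
Qed.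

Lemma selfadjointB n (X Y : 'M[C]_n) : selfadjoint X -> selfadjoint Y -> selfadjoint (X - Y).
Proof. by rewrite /selfadjoint daggerB => -> ->. Qed.

Lemma selfadjoint_sum n (I : Type) (s : seq I) (G : I -> 'M[C]_n) :
  (forall i, selfadjoint (G i)) -> selfadjoint (\sum_(i <- s) G i).
Proof.
move=> hG; apply: big_ind => // [|X Y hX hY]; first by rewrite /selfadjoint /dagger trmx0 map_mx0.
by rewrite /selfadjoint /dagger linearD map_mxD; congr (_ + _).
Qed.

Lemma selfadjoint_conj n (X Y : 'M[C]_n) :
  selfadjoint X -> selfadjoint Y -> selfadjoint (X *m Y *m X).
Proof. by rewrite /selfadjoint !daggerM => -> ->; rewrite mulmxA. Qed.

Lemma mxtrace_selfadjoint_sq n (X : 'M[C]_n) : selfadjoint X ->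
  \tr (X *m X) = \sum_i \sum_j `|X i j| ^+ 2.
Proof.
move=> hX; apply: eq_bigr => i _; rewrite mxE; apply: eq_bigr => j _.
by rewrite normCK -daggerE hX.
Qed.

Lemma mxtrace_selfadjoint_ge0 n (X : 'M[C]_n) : selfadjoint X -> 0 <= \tr (X *m X).
Proof.
move=> hX; rewrite mxtrace_selfadjoint_sq //; apply: sumr_ge0 => i _.
by apply: sumr_ge0 => j _; rewrite exprn_ge0.
Qed.

Lemma mxtrace_selfadjoint_eq0 n (X : 'M[C]_n) : selfadjoint X -> \tr (X *m X) <= 0 -> X = 0.
Proof.
move=> hX tr0; have /eqP : \tr (X *m X) = 0.
  by apply/eqP; rewrite eq_le tr0 mxtrace_selfadjoint_ge0.
rewrite mxtrace_selfadjoint_sq // psumr_eq0 => [/allP h|i _]; last first.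
  by apply: sumr_ge0 => j _; rewrite exprn_ge0.
apply/matrixP => i j; have := h i (mem_index_enum _); rewrite psumr_eq0 => [/allP h'|k _].
  by have := h' j (mem_index_enum _); rewrite sqrf_eq0 normr_eq0 mxE => /eqP.
by rewrite exprn_ge0.
Qed.

(** The two bounds add up to Tr((X - Y)^2) <= 0. The factor [c] will be 1/d. *)
Lemma selfadjoint_eq n (c : C) (X Y : 'M[C]_n) : 0 < c ->
    selfadjoint X -> selfadjoint Y ->
    \tr (X *m X) * c <= \tr (X *m Y) * c -> \tr (Y *m Y) * c <= \tr (X *m Y) * c ->
  X = Y.
Proof.
move=> c0 hX hY; rewrite !ler_pM2r // => h1 h2.
apply/eqP; rewrite -subr_eq0; apply/eqP/mxtrace_selfadjoint_eq0; first exact: selfadjointB.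
rewrite mulmxBl !mulmxBr !mxtraceD !raddfN /= raddfB /= [\tr (Y *m X)]mxtrace_mulC.
by rewrite opprB addrACA -opprD subr_le0 lerD.
Qed.

Lemma ptr_r_selfadjoint d (R : 'M[C]_(d * d)) : selfadjoint R -> selfadjoint (ptr_r R).
Proof.
move=> hR; apply/matrixP => i j; rewrite daggerE !mxE rmorphM fmorphV rmorph_nat.
rewrite rmorph_sum; congr (_ * _); apply: eq_bigr => k _.
exact: selfadjointE.
Qed.

Lemma ptr_l_selfadjoint d (R : 'M[C]_(d * d)) : selfadjoint R -> selfadjoint (ptr_l R).
Proof.
move=> hR; apply/matrixP => i j; rewrite daggerE !mxE rmorphM fmorphV rmorph_nat.
rewrite rmorph_sum; congr (_ * _); apply: eq_bigr => k _.
exact: selfadjointE.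
Qed.

End Dagger.

(** In the order of [K[i]] a nonnegative number is real: m = 0 and m = 1 make both imaginary parts
    vanish, and the Archimedean property settles the real part of [x]. *)
Lemma complex_archi_ge0 (K : realType) (x y : K[i]) :
  (forall m : nat, 0 <= y + m%:R * x) -> 0 <= x.
Proof.
case: x y => c e [a b] h.
have hm m : (b + m%:R * e == 0) && (0 <= a + m%:R * c).
  by have := h m; rewrite -(rmorph_nat (real_complex K)) lecE /= !mul0r subr0 addr0.
have [/eqP] := andP (hm 0%N); rewrite mul0r addr0 => b0 _.
have [/eqP] := andP (hm 1%N); rewrite b0 add0r mul1r => e0 _.
rewrite lecE /= e0 eqxx /= leNgt; apply/negP => c0.
have := archi_boundP (normr_ge0 (a / c)); set m := Num.bound _ => am.
have [_] := andP (hm m); apply/negP; rewrite -ltNge.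
have : m%:R * c < `|a / c| * c by rewrite ltr_nM2r.
rewrite normf_div (ltr0_norm c0) invrN mulrN mulNr divfK ?lt_eqF //.
by have := ler_norm a; lra.
Qed.

Section InvolutiveRMatrix.
Variables (K : realType) (d : nat).
Hypothesis d_gt0 : (0 < d)%N.
Local Notation C := K[i].
Variable R : 'M[C]_(d * d).
Hypothesis hR : involutive_Rmatrix R.
Local Notation t := (ptr_r R).
Local Notation t' := (ptr_l R).
Local Notation gen N := (fun k X => @yb_gen K d X N k).
Local Notation model N := (@tpow_model K d N d_gt0).

Lemma R_invol : R *m R = 1%:M. Proof. by case: hR. Qed.

Lemma R_selfadjoint : selfadjoint R.
Proof.
have [/unitarymxP RR _ _] := hR.
by rewrite /selfadjoint -[dagger R]mul1mx -R_invol -mulmxA [R *m dagger R]RR mulmx1.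
Qed.

Let t_herm : selfadjoint t. Proof. exact: ptr_r_selfadjoint R_selfadjoint. Qed.
Let t'_herm : selfadjoint t'. Proof. exact: ptr_l_selfadjoint R_selfadjoint. Qed.

Lemma gen_braid N k : (k.+2 < N)%N ->
  gen N k R * gen N k.+1 R * gen N k R = gen N k.+1 R * gen N k R * gen N k.+1 R.
Proof. by move=> kN; exact: (yb_gen_braid hR kN). Qed.

Lemma gen_selfadjoint N k : (k.+1 < N)%N -> selfadjoint (yb_gen R N k).
Proof. by move=> kN; rewrite /selfadjoint [LHS](dagger_emb _ (gen_dim d_gt0 kN)) R_selfadjoint. Qed.

Lemma site_selfadjoint N k (a : 'M[C]_d) : (k < N)%N -> selfadjoint a ->
  selfadjoint (tpow_site N k a).
Proof. by move=> kN ha; rewrite /selfadjoint /tpow_site (dagger_emb _ (site_dim d_gt0 kN)) ha. Qed.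

Lemma tau_selfadjoint_ge0 N (X : 'M[C]_(d ^ N)) : selfadjoint X -> 0 <= tpow_tau (X * X).
Proof.
move=> hX; rewrite /tpow_tau mulr_ge0 ?invr_ge0 ?exprn_ge0 ?ler0n //.
exact: mxtrace_selfadjoint_ge0.
Qed.

Lemma swap_selfadjoint n (s : nat -> 'M[C]_n) j :
  (forall i, (i <= j)%N -> selfadjoint (s i)) -> selfadjoint (swap s j).
Proof.
elim: j => [|j IH] hs; first exact: hs.
by apply: selfadjoint_conj; [exact: hs | apply: IH => i ij; apply: hs; exact: leqW].
Qed.

Let star_ge0 (x c : C) : (forall M, 0 <= M%:R * (x + M.-1%:R * c)) -> 0 <= c.
Proof.
move=> h; apply: (@complex_archi_ge0 _ _ x) => m.
by have := h m.+1; rewrite /= pmulr_rge0 // ltr0n.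
Qed.

Lemma tr_le_r : \tr (t *m t) / d%:R <= \tr (t *m t') / d%:R.
Proof.
rewrite -subr_ge0; apply: (@star_ge0 (1 - \tr (t *m t) / d%:R)) => M.
rewrite -(tau_star_r (model M.+1) R_invol (@gen_braid _) erefl).
apply/tau_selfadjoint_ge0/selfadjoint_sum => j; apply: selfadjointB; last exact: site_selfadjoint.
by apply: swap_selfadjoint => i ij; apply: gen_selfadjoint; have := ltn_ord j; lia.
Qed.

Lemma tr_le_l : \tr (t' *m t') / d%:R <= \tr (t *m t') / d%:R.
Proof.
rewrite -subr_ge0; apply: (@star_ge0 (1 - \tr (t' *m t') / d%:R)) => M.
rewrite -(tau_star_l (model M.+1) R_invol (@gen_braid _) erefl).
apply/tau_selfadjoint_ge0/selfadjoint_sum => j; apply: selfadjointB; last exact: site_selfadjoint.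
by apply: swap_selfadjoint => i ij; apply: gen_selfadjoint; have := ltn_ord j; lia.
Qed.

Lemma ptr_lr : t = t'.
Proof.
have d0 : 0 < (d%:R : C)^-1 by rewrite invr_gt0 ltr0n.
exact: selfadjoint_eq d0 t_herm t'_herm tr_le_r tr_le_l.
Qed.

Lemma tr_yb_gen N k (X : 'M[C]_(d * d)) : (k.+1 < N)%N ->
  \tr (yb_gen X N k) = (d ^ k * d ^ (N - k - 2))%:R * \tr X.
Proof. by move=> kN; exact: tr_emb (gen_dim d_gt0 kN) _. Qed.

(** The difference of the two sides is self-adjoint, and its copy on the middle sites of the fourth
    tensor power has a square of trace 0. That trace is a nonzero multiple of the trace on V (x)
    V. *)
Lemma ptr_covariant_base : R *m (t *t 1%:M) *m R = 1%:M *t t.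
Proof.
have gM := sm_genM (model 4).
pose X := R *m (t *t 1%:M) *m R - 1%:M *t t.
have genX : yb_gen X 4 1 = yb_gen R 4 1 * tpow_site 4 1 t * yb_gen R 4 1 - tpow_site 4 2 t.
  rewrite (sm_genB (model 4)) // !gM // !(sm_gen_tens (model 4)) //.
  by rewrite !(sm_site1 (model 4)) // mulr1 mul1r.
have hX : selfadjoint X.
  apply: selfadjointB; last first.
    by rewrite /selfadjoint /dagger trmx_tens map_mxT trmx1 map_mx1 -/(dagger t) t_herm.
  apply: selfadjoint_conj; first exact: R_selfadjoint.
  by rewrite /selfadjoint /dagger trmx_tens map_mxT trmx1 map_mx1 -/(dagger t) t_herm.
apply/eqP; rewrite -subr_eq0; apply/eqP/(mxtrace_selfadjoint_eq0 hX).
have := tau_covariance (model 4) R_invol (@gen_braid _) erefl ptr_lr.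
rewrite /= -genX -gM // /tpow_tau tr_yb_gen // => /eqP.
rewrite !mulf_eq0 invr_eq0 expf_eq0 !pnatr_eq0 muln_eq0 !expn_eq0 /=.
by rewrite !(gtn_eqF d_gt0) /= => /eqP->.
Qed.

Lemma ptr_covariant N : covariant N (@tpow_site K d N) (gen N) R t.
Proof.
move=> k kN.
have gM := sm_genM (model N) _ _ kN; have gT := sm_gen_tens (model N) _ _ kN.
have <- : yb_gen (1%:M *t t) N k = tpow_site N k.+1 t.
  by rewrite gT (sm_site1 (model N)) ?mul1r // ltnW.
have <- : yb_gen (t *t 1%:M) N k = tpow_site N k t.
  by rewrite gT (sm_site1 (model N)) ?mulr1.
by rewrite -[LHS]gM -[RHS]gM -ptr_covariant_base -!mulmxA R_invol mulmx1.
Qed.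

End InvolutiveRMatrix.

(** * The spectrum of the partial trace *)

(** In a full-rank factorization X = c l, idempotence cancels to l c = 1, of size the rank, and Tr
    (c l) = Tr (l c). *)
Lemma mxtrace_idempotent (F : fieldType) n (X : 'M[F]_n) :
  X *m X = X -> \tr X = (\rank X)%:R.
Proof.
have cancel r (c : 'M[F]_(n, r)) (l Z : 'M[F]_(r, n)) (Y : 'M[F]_(n, r)) :
    l *m Y = 1%:M -> Z *m c = 1%:M -> (c *m l) *m (c *m l) = c *m l -> l *m c = 1%:M.
  move=> lY Zc /(congr1 (fun W => Z *m W *m Y)) /=.
  by rewrite !mulmxA Zc mul1mx -!mulmxA lY mulmx1.
move=> XX.
have /row_freeP[Y lY] := row_base_free X; have /row_fullP[Z Zc] := col_base_full X.
have rc : row_base X *m col_base X = 1%:M by apply: (cancel _ _ _ _ _ lY Zc); rewrite mulmx_base.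
by rewrite -{1}[X]mulmx_base mxtrace_mulC rc mxtrace1.
Qed.

(* The products below are N! times the dimensions of the N-th exterior
   powers of a super vector space: they force [m = k * y] and [y ^ k] natural. *)
Lemma nat_of_falling_products (K : archiRealFieldType) (m : nat) (y : K) :
    (0 < m)%N -> 0 <= y ->
    (forall N, exists n : nat, \prod_(i < N) (m%:R - i%:R * y) = (N`! * n)%:R) ->
  exists k : nat, (0 < k)%N /\ y = k%:R.
Proof.
move=> m0; rewrite le_eqVlt => /predU1P[<-|y0] h.
  (* For y = 0 the product is m^N. Taking N = p prime above m is contradictory: p divides p! but not
     m^p. *)
  have [p mp p_prime] := prime_above m; have [n] := h p.
  under eq_bigr do rewrite mulr0 subr0.
  rewrite prodr_const card_ord -natrX => /eqP; rewrite eqr_nat => /eqP E.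
  have : (p %| m ^ p)%N by rewrite E dvdn_mulr // dvdn_fact ?prime_gt0 ?leqnn.
  by rewrite Euclid_dvdX // => /andP[/(dvdn_leq m0)]; rewrite leqNgt mp.
(* Stop at the first negative factor: were all earlier ones nonzero, they would be positive and the
   product negative. *)
have [k mk] : exists k : nat, m%:R = k%:R * y.
  have ex_neg : exists i : nat, m%:R - i%:R * y < 0.
    exists (Num.bound (m%:R / y)); rewrite subr_lt0 -ltr_pdivrMr //.
    by apply: archi_boundP; rewrite divr_ge0 // ltW.
  case: (ex_minnP ex_neg) => k; set q := fun i : nat => m%:R - i%:R * y.
  move=> qk kmin; have [/existsP[i /eqP qi]|/existsPn nz] := boolP [exists i : 'I_k, q i == 0].
    by exists i; apply/eqP; rewrite -subr_eq0 -[_ - _]/(q i) qi.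
  have [n] := h k.+1; rewrite big_ord_recr /= => E.
  have : \prod_(i < k) q i * q k < 0.
    rewrite nmulr_llt0 //; apply: prodr_gt0 => i _; rewrite lt_neqAle eq_sym nz leNgt.
    by apply/negP => /kmin; rewrite leqNgt ltn_ord.
  by rewrite E ltNge ler0n.
have k0 : (0 < k)%N.
  by case: k mk => // /eqP; rewrite mul0r pnatr_eq0 => /eqP m_eq0; rewrite m_eq0 in m0.
have [n] := h k.
have -> : \prod_(i < k) (m%:R - i%:R * y) = y ^+ k * k`!%:R.
  rewrite (eq_bigr (fun i : 'I_k => y * (k - i)%:R)) => [|i _]; last first.
    by rewrite mk natrB ?(ltnW (ltn_ord i)) //; ring.
  rewrite big_split /= prodr_const card_ord; congr (_ * _).
  rewrite -natr_prod fact_prod big_add1 big_mkord (reindex_inj rev_ord_inj) /=.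
  by congr (_%:R); apply: eq_bigr => i _; rewrite subKn.
rewrite natrM mulrC => /mulfI; rewrite pnatr_eq0 -lt0n fact_gt0 => /(_ isT) yk.
(* Since m^k = k^k y^k with y^k natural, k^k divides m^k. *)
have km : (k %| m)%N.
  rewrite -(dvdn_pexp2r _ _ k0); apply/dvdnP; exists n; apply/eqP.
  by rewrite -(eqr_nat K) natrM !natrX mk exprMn yk mulrC.
have kn0 : k%:R != 0 :> K by rewrite pnatr_eq0 -lt0n.
exists (m %/ k)%N; split; first by rewrite divn_gt0 // dvdn_leq.
by apply: (mulfI kn0); rewrite -mk -natrM mulnC divnK.
Qed.

Section ConjDiag.
Variables (F : fieldType) (d : nat) (U : 'M[F]_d).
Hypothesis U_unit : U \in unitmx.
Implicit Types f g : 'I_d -> F.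

(** Functional calculus in a fixed eigenbasis: sums, products and powers of such matrices are
    pointwise in [f]. *)
Definition conj_diag f : 'M[F]_d := invmx U *m diag_mx (\row_j f j) *m U.

Lemma conj_diagM f g : conj_diag f *m conj_diag g = conj_diag (fun j => f j * g j).
Proof.
rewrite /conj_diag !mulmxA -[_ *m U *m invmx U]mulmxA mulmxV // mulmx1.
rewrite -[_ *m diag_mx _ *m diag_mx _]mulmxA mulmx_diag.
by congr (_ *m diag_mx _ *m _); apply/rowP => j; rewrite !mxE.
Qed.

Lemma conj_diagD f g : conj_diag f + conj_diag g = conj_diag (fun j => f j + g j).
Proof.
rewrite /conj_diag -mulmxDl -mulmxDr -raddfD /=.
by congr (_ *m diag_mx _ *m _); apply/rowP => j; rewrite !mxE.
Qed.

Lemma conj_diag_scalar c : conj_diag (fun=> c) = c%:M.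
Proof.
rewrite /conj_diag (_ : \row_j c = const_mx c); last by apply/rowP => j; rewrite !mxE.
by rewrite diag_const_mx mul_mx_scalar -scalemxAl mulVmx // scalemx1.
Qed.

Lemma conj_diagZ c f : c *: conj_diag f = conj_diag (fun j => c * f j).
Proof. by rewrite -conj_diagM conj_diag_scalar mul_scalar_mx. Qed.

Lemma tr_conj_diag f : \tr (conj_diag f) = \sum_j f j.
Proof.
rewrite /conj_diag mxtrace_mulC mulmxA mulmxV // mul1mx mxtrace_diag.
by apply: eq_bigr => j _; rewrite mxE.
Qed.

Lemma conj_diag_iter f n : iter n (mulmx (conj_diag f)) 1%:M = conj_diag (fun j => f j ^+ n).
Proof.
elim: n => [|n IH] /=; first by rewrite -conj_diag_scalar; congr conj_diag; apply/funext.
by rewrite IH conj_diagM; congr conj_diag; apply/funext => j; rewrite exprS.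
Qed.

(* The spectral projections are polynomials, by Lagrange interpolation. *)
Lemma conj_diag_eq_ind f (Q : 'M[F]_d -> Prop) :
    (forall X Y, Q X -> Q Y -> Q (X *m Y)) -> (forall X Y, Q X -> Q Y -> Q (X + Y)) ->
    (forall c, Q c%:M) -> Q (conj_diag f) ->
  forall x, Q (conj_diag (fun j => (f j == x)%:R)).
Proof.
move=> QM QD Qc Qf x.
have Qp (p : {poly F}) : Q (conj_diag (fun j => p.[f j])).
  elim/poly_ind: p => [|p c IH].
    have := Qc 0; rewrite -conj_diag_scalar; congr (Q (conj_diag _)).
    by apply/funext => j; rewrite horner0.
  have := QD _ _ (QM _ _ IH Qf) (Qc c); rewrite -conj_diag_scalar conj_diagM conj_diagD.
  by congr (Q (conj_diag _)); apply/funext => j; rewrite hornerMXaddC.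
(* There is one factor per index, so repeated eigenvalues repeat factors; the product still is 1 at
   x and 0 at every other eigenvalue. *)
pose p := \prod_(j | f j != x) ((x - f j)^-1 *: ('X - (f j)%:P)).
have := Qp p; congr (Q (conj_diag _)); apply/funext => j.
rewrite horner_prod; have [->|fj] := eqVneq (f j) x.
  rewrite big1 // => i fi; rewrite hornerZ hornerXsubC mulVf // subr_eq0 eq_sym //.
by rewrite (bigD1 j) //= hornerZ hornerXsubC subrr mulr0 mul0r.
Qed.

End ConjDiag.

Section Spectrum.
Variables (K : realType) (d : nat).
Hypothesis d_gt0 : (0 < d)%N.
Local Notation C := K[i].
Variable R : 'M[C]_(d * d).
Hypothesis hR : involutive_Rmatrix R.
Local Notation t := (ptr_r R).
Local Notation gen N := (fun k X => @yb_gen K d X N k).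
Local Notation model N := (@tpow_model K d N d_gt0).
Local Notation cov N := (covariant N (@tpow_site K d N) (gen N) R).

Lemma covariant_scalar N c : cov N c%:M.
Proof.
move=> k kN; rewrite -scalemx1 /tpow_site.
rewrite (embZ (site_dim d_gt0 kN)) (embZ (site_dim d_gt0 (ltnW kN))).
rewrite (emb1 _ (site_dim d_gt0 kN)) (emb1 _ (site_dim d_gt0 (ltnW kN))).
by rewrite -[LHS]scalemxAr -[RHS]scalemxAl mulmx1 mul1mx.
Qed.

Let T_selfadjoint : selfadjoint t. Proof. exact: ptr_r_selfadjoint (R_selfadjoint hR). Qed.

(** The product S of the tensor power of [P] with the (anti)symmetrizer satisfies S^2 = N! S, so Tr
    S is N! times the rank of S / N!. Spreading d^N over the N factors clears the denominators. *)
Lemma eigenprojection_products (P : 'M[C]_d) (m : nat) (y : C) sgn N :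
    (forall N, cov N P) -> P *m P = P -> P *m t = y *: P -> \tr P = m%:R ->
  exists n : nat, \prod_(i < N) (m%:R + (-1) ^+ sgn * (i%:R * (d%:R * y))) = (N`! * n)%:R.
Proof.
move=> P_cov PP Pt trP.
have d0 : d%:R != 0 :> C by rewrite pnatr_eq0 -lt0n.
have RI := R_invol hR; have GB := @gen_braid _ _ _ hR.
set S := site_prod (@tpow_site K d N) P N *
  symm (fun k => gen N k R) ((-1) ^+ sgn) N.
have tauS := tau_site_prod_symm (model N) RI (@GB N) sgn (P_cov N) PP Pt (leqnn N).
have SS := site_prod_symm_sq (model N) RI (@GB N) sgn (P_cov N) PP.
rewrite -/S in tauS SS.
clearbody S.
have {tauS} trS : \tr S = \prod_(i < N) (m%:R + (-1) ^+ sgn * (i%:R * (d%:R * y))).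
  rewrite -[\tr S](mulVKf (expf_neq0 N d0)) -/(tpow_tau S) tauS.
  rewrite -{1}(card_ord N) -prodr_const -big_split /=; apply: eq_bigr => i _.
  by rewrite trP mulrDr mulrCA divff // mulr1 !mulrA; congr (_ + _); ring.
have N0 : N`!%:R != 0 :> C by rewrite pnatr_eq0 -lt0n fact_gt0.
pose Y := (N`!%:R : C)^-1 *: S.
have YY : Y *m Y = Y.
  rewrite /Y -scalemxAl -scalemxAr [S *m S]SS.
  rewrite (_ : S *+ N`! = (N`!%:R : C) *: S); last by rewrite scaler_nat.
  by rewrite [X in _ *: X]scalerA mulVf // scale1r.
exists (\rank Y); rewrite -trS natrM -(mxtrace_idempotent YY) mxtraceZ.
by rewrite mulVKf.
Qed.

Lemma ptr_spectrum : exists x : 'I_d -> K,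
  (forall i, exists k : nat, (0 < k)%N /\ d%:R * `|x i| = k%:R) /\
  (forall n, \tr (iter n (mulmx t) 1%:M) = (\sum_i x i ^+ n)%:C%C).
Proof.
have t_herm : t \is hermsymmx.
  by apply/is_hermitianmxP; rewrite expr0 scale1r -[RHS]/(dagger t) T_selfadjoint.
have t_norm := hermitian_normalmx t_herm.
have /mxOverP sp_real := hermitian_spectral_diag_real t_herm.
set U := spectralmx t; set sp := spectral_diag t in sp_real.
have U_unit : U \in unitmx by exact: spectral_unit.
pose x i := complex.Re (sp 0 i).
have xE i : (x i)%:C%C = sp 0 i by rewrite RRe_real.
have tE : t = conj_diag U (fun i => (x i)%:C%C).
  have /orthomx_spectralP tE0 := t_norm; apply: etrans tE0 _.
  apply: (congr1 (fun v => invmx U *m diag_mx v *m U)).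
  by apply/rowP => i; rewrite mxE xE.
exists x; split; last first.
  move=> n; rewrite [in LHS]tE (conj_diag_iter U_unit) (tr_conj_diag U_unit) rmorph_sum.
  by apply: eq_bigr => i _; rewrite rmorphXn.
move=> i; pose P := conj_diag U (fun j => ((x j)%:C%C == (x i)%:C%C)%:R).
have P_cov N : cov N P.
  apply: (conj_diag_eq_ind U_unit (Q := cov N)).
  - exact: (covariantM (model N)).
  - exact: (covariantD (model N)).
  - exact: covariant_scalar.
  - by rewrite -tE; exact: ptr_covariant.
have PP : P *m P = P.
  rewrite /P (conj_diagM U_unit); apply: (congr1 (conj_diag U)); apply/funext => j.
  by case: eqP; rewrite ?mulr0 ?mulr1.
have Pt : P *m t = (x i)%:C%C *: P.
  rewrite [in LHS]tE (conj_diagM U_unit) (conj_diagZ U_unit).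
  apply: (congr1 (conj_diag U)); apply/funext => j.
  by case: eqP => [->|_]; rewrite ?mulr0 ?mul0r ?mulr1 ?mul1r.
pose m := (\sum_j (x j == x i))%N.
have trP : \tr P = m%:R.
  rewrite (tr_conj_diag U_unit) natr_sum; apply: eq_bigr => j _.
  by rewrite (inj_eq (fmorph_inj (real_complex K))).
have m0 : (0 < m)%N by rewrite /m (bigD1 i) //= eqxx.
(* The antisymmetrizer is used for x i >= 0 and the symmetrizer for x i < 0, so the j-th factor is m
   - j d |x i| in both cases. *)
have h N := eigenprojection_products (nat_of_bool (0 <= x i)%R) N P_cov PP Pt trP.
have := @nat_of_falling_products K m (d%:R * `|x i|) m0 _ _.
apply; first by rewrite mulr_ge0 ?ler0n.
move=> N; have [n hn] := h N; exists n.
apply: (fmorph_inj (real_complex K)); rewrite rmorph_nat -hn rmorph_prod.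
apply: eq_bigr => j _; rewrite rmorphB !rmorphM !rmorph_nat /=.
have -> : `|x i| = - ((-1) ^+ (0 <= x i)%R * x i).
  by case: ger0P => _; rewrite ?mulN1r ?mul1r ?opprK.
rewrite rmorphN rmorphM rmorph_sign !mulrN opprK; apply: (congr1 (+%R _)).
by rewrite [X in _ * X = _]mulrCA [LHS]mulrCA.

Qed.

End Spectrum.

(** * Cycle decompositions in the infinite symmetric group *)

Lemma sinf_fixV (s : Sinf) i : s i = i -> (s^-1)%g i = i.
Proof. by move=> si; rewrite -{1}si; exact: sinf_funK. Qed.

Lemma sinf_stabV n s : sinf_stab n s -> sinf_stab n (s^-1)%g.
Proof. by move=> hs i hi; apply/sinf_fixV/hs. Qed.

Lemma sinfVK (s : Sinf) : cancel s (s^-1)%g. Proof. exact: sinf_funK. Qed.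
Lemma sinfKV (s : Sinf) : cancel (s^-1)%g s. Proof. exact: sinf_invfunK. Qed.

Lemma next_notin (l : seq nat) x : x \notin l -> next l x = x.
Proof. by move=> xl; rewrite next_nth (negbTE xl). Qed.

Lemma next_neq (l : seq nat) x : uniq l -> (2 <= size l)%N -> x \in l -> next l x <> x.
Proof.
move=> Ul sl xl; case: l Ul sl xl => [|y [|z l]] // Ul _ xl.
set l' := [:: y, z & l] in Ul xl *.
have [i l'E] : exists i, rot i l' = x :: behead (rot i l').
  by have [i p E] := rot_to xl; exists i; rewrite E.
rewrite -(next_rot i Ul) l'E; have : uniq (rot i l') by rewrite rot_uniq.
have : size (rot i l') = (size l).+2 by rewrite size_rot.
rewrite l'E /=; case: (behead _) => [|w p] //= _ /andP[xp _]; rewrite eqxx => E.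
by rewrite E mem_head in xp.
Qed.

Section CycleOfSeq.
Variable l : seq nat.
Hypothesis l_uniq : uniq l.

Lemma next_fin : finite_set [set i | next l i != i].
Proof.
apply: (sub_finite_set (B := [set` l])) => [i /=|]; last exact: finite_seq.
by apply: contraNT => /next_notin->.
Qed.

Definition cycle_perm : Sinf :=
  MkSinf (Bijective (prev_next l_uniq) (next_prev l_uniq)) next_fin.

End CycleOfSeq.

Definition swap_fun (a b i : nat) : nat := if i == a then b else if i == b then a else i.

Lemma swap_funK a b : involutive (swap_fun a b).
Proof.
by move=> i; rewrite /swap_fun; do ![case: eqP => //=]; congruence.
Qed.

Lemma swap_fun_fin a b : finite_set [set i | swap_fun a b i != i].
Proof.
apply: (sub_finite_set (B := [set` [:: a; b]])) => [i /=|]; last exact: finite_seq.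
by rewrite /swap_fun !inE; do ![case: eqP => //=].
Qed.

Definition sinf_swap a b : Sinf :=
  MkSinf (Bijective (@swap_funK a b) (@swap_funK a b)) (swap_fun_fin a b).

Lemma sinf_stab_swap n a b : (a < n)%N -> (b < n)%N -> sinf_stab n (sinf_swap a b).
Proof. by move=> an bn i ni /=; rewrite /swap_fun; do ![case: eqP => //=]; lia. Qed.

(** Each new point is put in place by one transposition, which fixes the points already placed. *)
Lemma sinf_map_seq n (l l' : seq nat) : uniq l -> uniq l' -> size l = size l' ->
    (forall i, i \in l -> (i < n)%N) -> (forall i, i \in l' -> (i < n)%N) ->
  exists2 g : Sinf, sinf_stab n g & map g l = l'.
Proof.
elim: l l' => [|x l IH] [|y l'] //; first by move=> *; exists 1%g; first exact: sinf_stab1.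
move=> /= /andP[xl Ul] /andP[yl' Ul'] [sz] ln l'n.
have [i il|i il|g gn gl] := IH l' Ul Ul' sz.
- by apply: ln; rewrite inE il orbT.
- by apply: l'n; rewrite inE il orbT.
have gx : g x \notin l' by rewrite -gl mem_map //; exact: sinf_inj.
exists (sinf_swap (g x) y * g)%g.
  apply: sinf_stabM => //; apply: sinf_stab_swap; last by apply: l'n; rewrite mem_head.
  by apply: sinf_stab_lt gn _; apply: ln; rewrite mem_head.
rewrite /= /swap_fun eqxx; congr (_ :: _).
have -> : [seq (sinf_swap (g x) y * g)%g i | i <- l] = map (sinf_swap (g x) y) (map g l).
  by rewrite -map_comp.
rewrite gl -[RHS]map_id; apply/eq_in_map => i il' /=; rewrite /swap_fun.
case: eqP => [E|_]; first by rewrite -E il' in gx.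
by case: eqP => [E|//]; rewrite -E il' in yl'.
Qed.

Lemma cycle_conj (c g : Sinf) (l : seq nat) :
  c =1 next l -> uniq l -> (g * c * g^-1)%g =1 next (map g l).
Proof.
move=> cl Ul i /=; rewrite -{2}(sinfKV g i) next_map //; last exact: sinf_inj.
by rewrite /= cl.
Qed.

(* The cycle m -> m+1 -> ... -> m+i -> m. *)
Definition std_cycle m i : Sinf := (\prod_(m <= k < m + i) adj k)%g.

Lemma std_cycleS m i : std_cycle m i.+1 = (std_cycle m i * adj (m + i))%g.
Proof. by rewrite /std_cycle addnS big_nat_recr //= leq_addr. Qed.

Lemma std_cycleE m i x : std_cycle m i x =
  if (m <= x < m + i)%N then x.+1 else if x == (m + i)%N then m else x.
Proof.
elim: i x => [|i IH] x.
  rewrite /std_cycle addn0 big_geq //=; case: ifP => [|_]; first lia.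
  by case: eqP.
rewrite std_cycleS /= IH; have := adj_funE (m + i) x.
by do ![case: ifP => //]; lia.
Qed.

Lemma next_iota m i : next (iota m i.+1) =1 std_cycle m i.
Proof.
move=> x; rewrite next_nth std_cycleE mem_iota.
case: ifP => [hx|hx]; last by do ![case: ifP => //]; lia.
have -> : index x (iota m i.+1) = (x - m)%N.
  have {1}-> : x = nth 0%N (iota m i.+1) (x - m) by rewrite nth_iota; lia.
  by rewrite index_uniq ?iota_uniq ?size_iota //; lia.
rewrite /=; have [xi|xi] := ltnP (x - m) i.
  by rewrite nth_iota //; case: ifP => //; lia.
by rewrite nth_default ?size_iota //; do ![case: ifP => //]; lia.
Qed.

Lemma sinf_stab_std_cycle m i : sinf_stab (m + i).+1 (std_cycle m i).
Proof. by move=> x hx; rewrite std_cycleE; do ![case: ifP => //]; lia. Qed.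

Definition is_cycle (c : Sinf) := exists2 n, (2 <= n)%N & is_ncycle n c.

Lemma prod_fix (cs : seq Sinf) i : (forall c : Sinf, c \in cs -> c i = i) ->
  (\prod_(c <- cs) c)%g i = i.
Proof.
elim: cs => [|c cs IH] h; first by rewrite big_nil.
rewrite big_cons /= IH ?h ?mem_head // => c' c'cs; apply: h.
by rewrite inE c'cs orbT.
Qed.

(** Restricting [s] to ['I_n.+1] makes the orbits of a finite type available; the list is the orbit
    of the top point. *)
Lemma orbit_seq n (s : Sinf) : sinf_stab n.+1 s -> s n <> n ->
  exists l : seq nat, [/\ uniq l, (2 <= size l)%N, n \in l,
    forall i, i \in l -> (i < n.+1)%N & {in l, next l =1 s}].
Proof.
move=> hs sn.
pose f (i : 'I_n.+1) : 'I_n.+1 := Ordinal (sinf_stab_lt hs (ltn_ord i)).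
have f_inj : injective f by move=> i j /(congr1 val) /= /sinf_inj /val_inj.
pose o := fingraph.orbit f ord_max; exists (map val o).
have Uo : uniq o by exact: orbit_uniq.
have fo : fcycle f o by exact: cycle_orbit.
have no : ord_max \in o by exact: in_orbit.
have nE i : i \in o -> next (map val o) (val i) = s (val i).
  by move=> io; rewrite next_map // -(eqP (next_cycle fo io)).
split.
- by rewrite map_inj_uniq.
- rewrite size_map; case: o no nE {Uo fo} => [|x [|y o]] //.
  by rewrite inE => /eqP <- /(_ _ (mem_head _ _)) /=; rewrite eqxx => /esym.
- exact: map_f no.
- by move=> i /mapP[j _ ->]; exact: ltn_ord.
- by move=> i /mapP[j jo ->]; exact: nE.
Qed.

(** The cycle through the top point is split off. The last clause carries the induction: the
    remaining cycles move only what the rest of [s] moves, hence are disjoint from that cycle. *)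
Lemma cycle_decomposition n s : sinf_stab n s -> exists cs : seq Sinf,
  [/\ forall c, c \in cs -> is_cycle c,
      pairwise (fun s t => `[< disjoint_supp s t >]) cs,
      s = (\prod_(c <- cs) c)%g &
      forall c : Sinf, c \in cs -> forall i, s i = i -> c i = i].
Proof.
elim: n s => [|n IH] s hs.
  by exists [::]; split=> //; rewrite big_nil; apply: sinfP => i; exact: hs.
have stabW (u : Sinf) : sinf_stab n.+1 u -> u n = n -> sinf_stab n u.
  by move=> hu un i; rewrite leq_eqVlt => /predU1P[<-//|]; exact: hu.
have [sn|/eqP sn] := eqVneq (s n) n; first by apply: IH; exact: stabW.
have [l [Ul sl nl ln nextE]] := orbit_seq hs sn.
pose c := cycle_perm Ul; pose s' := (c^-1 * s)%g.
have s_notin i : i \notin l -> s i \notin l.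
  apply: contra => sil; have pl : prev l (s i) \in l by rewrite mem_prev.
  suff <- : prev l (s i) = i by [].
  by apply: (@sinf_inj s); rewrite -nextE // next_prev.
have s'_in i : i \in l -> s' i = i.
  by move=> il; rewrite /s' /= -nextE //; exact: (sinfVK c).
have s'_notin i : i \notin l -> s' i = s i.
  by move=> il; rewrite /s' /=; apply: (@sinf_fixV c); apply: next_notin; exact: s_notin.
have [|cs [cyc_cs dis_cs s'E fix_cs]] := IH s'.
  apply: (stabW); last exact: s'_in.
  by move=> i ni; rewrite s'_notin ?hs //; apply: contraL ni => /ln; rewrite ltnNge.
have fix_notin i : s i = i -> i \notin l.
  by move=> si; apply/negP => il; apply: (next_neq Ul sl il); rewrite nextE.
exists (c :: cs); split.
- move=> c'; rewrite inE => /predU1P[->|/cyc_cs //].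
  by exists (size l) => //; exists l.
- rewrite /= dis_cs andbT; apply/allP => c' c'cs; apply/asboolP => i.
  have [il|il] := boolP (i \in l); last by left; exact: next_notin.
  by right; apply: fix_cs => //; exact: s'_in.
- by rewrite big_cons -s'E /s' mulgA mulgV mul1g.
- move=> c' + i si; rewrite inE => /predU1P[->|c'cs].
    by apply: next_notin; exact: fix_notin.
  by apply: fix_cs => //; rewrite s'_notin ?si //; exact: fix_notin.
Qed.

(** * Yang-Baxter characters on cycles *)

Section YangBaxterCharacter.
Variables (K : realType) (d : nat).
Hypothesis d_gt0 : (0 < d)%N.
Local Notation C := K[i].
Variable R : 'M[C]_(d * d).
Hypothesis hR : involutive_Rmatrix R.
Local Notation t := (ptr_r R).
Local Notation gen N := (fun k X => @yb_gen K d X N k).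
Local Notation model N := (@tpow_model K d N d_gt0).
Local Notation chi := (yb_char R).

Lemma yb_char_tau n s : (0 < n)%N -> sinf_stab n s -> chi s = tpow_tau (yb_rep R n s).
Proof. exact: yb_charE. Qed.

Lemma yb_repM n s u : sinf_stab n s -> sinf_stab n u ->
  yb_rep R n (s * u)%g = yb_rep R n s * yb_rep R n u.
Proof. by move=> hs hu; have [_ h _] := yb_repP hR n; apply: h; rewrite inE. Qed.

Lemma yb_rep1 n : yb_rep R n 1%g = 1.
Proof. by have [-> _ _] := yb_repP hR n. Qed.

Lemma yb_rep_adj n k : (k.+1 < n)%N -> yb_rep R n (adj k) = gen n k R.
Proof. by move=> kn; have [_ _ h] := yb_repP hR n; exact: h. Qed.

Lemma yb_char1 : chi 1%g = 1.
Proof. by rewrite (@yb_char_tau 1) // yb_rep1; exact: sm_tau1 (model 1). Qed.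

Lemma yb_charJ s g : chi (g * s * g^-1)%g = chi s.
Proof.
have [n [n0 hs]] := sinf_stab_ex s; have [m [_ hg]] := sinf_stab_ex g.
have hs' : sinf_stab (n + m) s by apply: sinf_stabS hs; exact: leq_addr.
have hg' : sinf_stab (n + m) g by apply: sinf_stabS hg; exact: leq_addl.
have hV := sinf_stabV hg'; have gs := sinf_stabM hg' hs'.
have nm0 : (0 < n + m)%N by rewrite addn_gt0 n0.
rewrite (yb_char_tau nm0 (sinf_stabM gs hV)) (yb_char_tau nm0 hs').
rewrite (yb_repM gs hV) (sm_tauC (model _)) -(yb_repM hV gs).
by apply: congr1; apply: congr1; rewrite !mulgA mulVg mul1g.
Qed.

Lemma yb_rep_commutes n m s k : sinf_stab m s -> (m <= k < n)%N ->
  commutes_site (@tpow_site K d n) k (yb_rep R n s).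
Proof.
move=> hs /andP[mk kn]; elim/sinf_stab_ind: hs => [|j u jm hu IH].
  by rewrite yb_rep1; exact: commutes_site1.
rewrite yb_repM.
- apply: commutes_siteM => //; rewrite yb_rep_adj; last lia.
  by apply: (commutes_site_gen (model n)); lia.
- by apply: sinf_stab_adj; lia.
- by apply: sinf_stabS hu; lia.
Qed.

Lemma yb_rep_std_cycle n m i : (m + i < n)%N ->
  yb_rep R n (std_cycle m i) = \prod_(m <= k < m + i) gen n k R.
Proof.
elim: i => [|i IH] mi.
  by rewrite /std_cycle addn0 !big_geq // yb_rep1.
have mi' : (m + i < n)%N by lia.
have h1 : sinf_stab n (std_cycle m i) by apply: sinf_stabS (@sinf_stab_std_cycle m i).
have h2 : sinf_stab n (adj (m + i)) by apply: sinf_stab_adj; lia.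
rewrite std_cycleS (yb_repM h1 h2) (IH mi') yb_rep_adj; last lia.
by rewrite addnS big_nat_recr ?leq_addr.
Qed.

(** Conjugate so that the support of [c] becomes the last p points m, ..., n-1. Then [s] lands in
    S_m, its image commutes with the sites of the cycle, and [tau_cycle] applies. This yields both
    the value on cycles and multiplicativity. *)
Lemma yb_char_cycle (l : seq nat) (c s : Sinf) :
    uniq l -> (0 < size l)%N -> c =1 next l -> (forall i, i \in l -> s i = i) ->
  chi (c * s)%g = chi s * (\tr (iter (size l).-1 (mulmx t) 1%:M) / d%:R).
Proof.
move=> Ul l0 cl sl; set p := size l.
have [n [n0 hs ln]] : exists n, [/\ (0 < n)%N, sinf_stab n s & forall i, i \in l -> (i < n)%N].
  have [n [n0 hs]] := sinf_stab_ex s; exists (n + (\max_(i <- l) i).+1)%N.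
  split; [lia | apply: sinf_stabS hs; exact: leq_addr | move=> i il].
  by have /= := leq_bigmax_seq (P := xpredT) (F := fun i : nat => i) _ il isT; lia.
have pn : (p <= n)%N.
  rewrite -(size_iota 0 n); apply: uniq_leq_size => // i /ln.
  by rewrite mem_iota add0n.
pose m := (n - p)%N.
have [i|g gn gl] := sinf_map_seq Ul (iota_uniq m p) (esym (size_iota m p)) ln.
  by rewrite mem_iota; lia.
have gcE : (g * c * g^-1)%g = std_cycle m p.-1.
  by apply: sinfP => i; rewrite (cycle_conj g cl Ul) gl -next_iota prednK.
have hs' : sinf_stab m (g * s * g^-1)%g.
  move=> i mi; rewrite -[LHS]/(g (s (g^-1%g i))); have [ni|ni] := leqP n i.
    by rewrite [g^-1%g i](sinf_fixV (gn i ni)) hs // gn.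
  have : i \in map g l by rewrite gl mem_iota; lia.
  by move=> /mapP[j jl ->]; rewrite (sinfVK g) sl.
have mn : (m <= n)%N by exact: leq_subr.
have hs'n := sinf_stabS mn hs'.
have hz : sinf_stab n (std_cycle m p.-1).
  by apply: sinf_stabS (@sinf_stab_std_cycle m p.-1); lia.
have -> : chi (c * s)%g = chi (std_cycle m p.-1 * (g * s * g^-1))%g.
  by rewrite -(yb_charJ _ g) -gcE; congr chi; rewrite !mulgA -[(_ * g^-1 * g)%g]mulgA mulVg mulg1.
rewrite (yb_char_tau n0 (sinf_stabM hz hs'n)) (yb_repM hz hs'n).
rewrite -(yb_charJ s g) (yb_char_tau n0 hs'n) (sm_tauC (model n)).
rewrite yb_rep_std_cycle; last lia.
have hX k : (m <= k < n)%N ->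
    commutes_site (@tpow_site K d n) k (yb_rep R n (g * s * g^-1)%g).
  exact: yb_rep_commutes.
have mp : (m + p.-1 < n)%N by lia.
have := tau_cycle (model n) (R_invol hR) (@ptr_covariant _ _ d_gt0 _ hR n) 0 mp hX.
rewrite addn0 [iter 0 _ _]/= (sm_site1 (model n)); last lia.
by rewrite mulr1.
Qed.
End YangBaxterCharacter.

(** * Thoma parameters from moments *)

Section ThomaSpectrum.
Variables (K : realType) (d : nat) (alpha beta : nat -> K) (x : 'I_d -> K).
Hypothesis d_gt0 : (0 < d)%N.
Hypothesis thoma : thoma_domain alpha beta.
Hypothesis x_int : forall i, exists k : nat, (0 < k)%N /\ d%:R * `|x i| = k%:R.
Hypothesis moments : forall n,
  thoma_value alpha beta n.+2 = d%:R^-1 * \sum_i x i ^+ n.+1.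

Lemma thoma_ge0 (a : nat -> K) : (forall i, 0 <= a i.+1 <= a i) -> forall i, 0 <= a i.
Proof.
move=> h [|i]; last by case/andP: (h i).
by case/andP: (h 0%N) => h0 h1; exact: le_trans h1.
Qed.

Let alpha_ge0 : forall i, 0 <= alpha i. Proof. by case: thoma => /thoma_ge0. Qed.
Let beta_ge0 : forall i, 0 <= beta i. Proof. by case: thoma => _ /thoma_ge0. Qed.

Lemma thoma_partial_sums n : \sum_(0 <= i < n) alpha i + \sum_(0 <= i < n) beta i <= 1.
Proof.
have [_ _ le1] := thoma; rewrite -lee_fin; apply: le_trans le1.
rewrite EFinD -!sumEFin; apply: leeD; apply: nneseries_lim_ge => k _ _; by rewrite lee_fin.
Qed.

Let alpha_sum n : \sum_(0 <= i < n) alpha i <= 1.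
Proof.
apply: le_trans (thoma_partial_sums n); rewrite lerDl; exact: sumr_ge0.
Qed.

Let beta_sum n : \sum_(0 <= i < n) beta i <= 1.
Proof.
apply: le_trans (thoma_partial_sums n); rewrite lerDr; exact: sumr_ge0.
Qed.

Lemma series_homo (a : nat -> K) : (forall i, 0 <= a i) ->
  {homo series a : n m / (n <= m)%N >-> n <= m}.
Proof.
move=> a0; apply/nondecreasing_seqP => n.
by rewrite /series /= big_nat_recr //= lerDl.
Qed.

Lemma cvg_power_series (a : nat -> K) n : (forall i, 0 <= a i) ->
    (forall n, \sum_(0 <= i < n) a i <= 1) ->
  cvgn (series (fun i => a i ^+ n.+1)).
Proof.
move=> a0 a1; apply: nondecreasing_is_cvgn.
  by apply: series_homo => i; rewrite exprn_ge0.
exists 1 => _ [m _ <-]; apply: le_trans (a1 m); apply: ler_sum => i _.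
rewrite exprS ler_piMr // exprn_ile1 //; apply: le_trans (a1 i.+1).
by rewrite big_nat_recr //= lerDr sumr_ge0.
Qed.

(* [p] integrates to the same value against the measure
   [\sum_j alpha j \delta_(alpha j) + \sum_j beta j \delta_(- beta j)]
   and against the uniform measure on the [x i]. *)
Definition same_integral (p : {poly K}) : Prop := exists A B : K,
  [/\ series (fun j => alpha j * p.[alpha j]) @ \oo --> A,
      series (fun j => beta j * p.[- beta j]) @ \oo --> B &
      A + B = d%:R^-1 * \sum_i p.[x i]].

Lemma same_integralD p q : same_integral p -> same_integral q -> same_integral (p + q).
Proof.
move=> [A [B [hA hB AB]]] [A' [B' [hA' hB' AB']]]; exists (A + A'), (B + B'); split.
- have -> : (fun j => alpha j * (p + q).[alpha j]) =
    ((fun j => alpha j * p.[alpha j]) + (fun j => alpha j * q.[alpha j]))%R.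
    by apply/funext => j; rewrite hornerD mulrDr.
  by rewrite seriesD; exact: cvgD.
- have -> : (fun j => beta j * (p + q).[- beta j]) =
    ((fun j => beta j * p.[- beta j]) + (fun j => beta j * q.[- beta j]))%R.
    by apply/funext => j; rewrite hornerD mulrDr.
  by rewrite seriesD; exact: cvgD.
- rewrite addrACA AB AB' -mulrDr -big_split; congr (_ * _).
  by apply: eq_bigr => i _; rewrite hornerD.
Qed.

Lemma same_integralZ c p : same_integral p -> same_integral (c *: p).
Proof.
move=> [A [B [hA hB AB]]]; exists (c * A), (c * B); split.
- have -> : (fun j => alpha j * (c *: p).[alpha j]) = c *: (fun j => alpha j * p.[alpha j]).
    by apply/funext => j; rewrite hornerZ mulrCA.
  by rewrite seriesZ; exact: (@cvgMl_tmp _ _ _ _ _ c _ hA).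
- have -> : (fun j => beta j * (c *: p).[- beta j]) = c *: (fun j => beta j * p.[- beta j]).
    by apply/funext => j; rewrite hornerZ mulrCA.
  by rewrite seriesZ; exact: (@cvgMl_tmp _ _ _ _ _ c _ hB).
- rewrite -mulrDr AB mulrCA mulr_sumr; congr (_ * _).
  by apply: eq_bigr => i _; rewrite hornerZ.
Qed.

(** The moment of order n+1 is the value at an (n+2)-cycle; its sign is that of (- beta j)^(n+1). *)
Lemma same_integralXn n : same_integral 'X^(n.+1).
Proof.
exists (limn (series (fun j => alpha j ^+ n.+2))).
exists ((-1) ^+ n.+1 * limn (series (fun j => beta j ^+ n.+2))); split.
- have -> : (fun j => alpha j * ('X^(n.+1)).[alpha j]) = (fun j => alpha j ^+ n.+2).
    by apply/funext => j; rewrite hornerXn -exprS.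
  exact: cvg_power_series.
- have -> : (fun j => beta j * ('X^(n.+1)).[- beta j]) =
      (-1) ^+ n.+1 *: (fun j => beta j ^+ n.+2).
    by apply/funext => j; rewrite hornerXn (exprNn (beta j)) mulrCA -exprS.
  by rewrite seriesZ; apply: (@cvgMl_tmp _ _ _ _ _ ((-1) ^+ n.+1)); exact: cvg_power_series.
- have := moments n; rewrite /thoma_value [X in _ + X * _](_ : _ = (-1) ^+ n.+1); last first.
    by rewrite !exprS !mulN1r opprK.
  by move=> ->; congr (_ * _); apply: eq_bigr => i _; rewrite hornerXn.
Qed.

(** The constant term must vanish: no cycle gives the moment of order 0. *)
Lemma same_integral_root0 (p : {poly K}) : p.[0] = 0 -> same_integral p.
Proof.
move=> /eqP/factor_theorem[q ->]; rewrite subr0 -[q]coefK poly_def mulr_suml.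
apply: big_ind => [||i _]; last first.
- by rewrite -scalerAl -exprSr; apply/same_integralZ/same_integralXn.
- exact: same_integralD.
- by have := same_integralZ 0 (same_integralXn 0); rewrite scale0r.
Qed.

Let x_neq0 i : x i != 0.
Proof.
have [k [k0]] := x_int i; apply: contra_eqN => /eqP->.
by rewrite normr0 mulr0 eq_sym pnatr_eq0 -lt0n.
Qed.

Lemma nonneg_series_eq0 (a : nat -> K) (A : K) : (forall i, 0 <= a i) ->
  series a @ \oo --> A -> A <= 0 -> forall i, a i = 0.
Proof.
move=> a0 aA A0 i; apply/eqP; rewrite eq_le a0 andbT.
have aA' : limn (series a) = A by exact: cvg_lim aA.
apply: le_trans A0; rewrite -aA'.
apply: le_trans (nondecreasing_cvgn_le (series_homo a0) _ i.+1).
  by rewrite /series /= big_nat_recr //= lerDr sumr_ge0.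
by apply/cvg_ex; exists A.
Qed.

(** The test polynomial y^2 prod (y - x_i)^2 is nonnegative and vanishes on the spectrum, so its
    integral is 0 and every atom of positive weight is a root. The root 0 carries no weight, since
    the weight of an atom is its absolute value. *)
Lemma thoma_in_spectrum j :
  (alpha j = 0 \/ exists i, alpha j = x i) /\ (beta j = 0 \/ exists i, - beta j = x i).
Proof.
pose p : {poly K} := 'X * \prod_i ('X - (x i)%:P) ^+ 2 * 'X.
have pE y : p.[y] = y ^+ 2 * \prod_i (y - x i) ^+ 2.
  rewrite !hornerE horner_prod mulrC mulrA -expr2; congr (_ * _).
  by apply: eq_bigr => i _; rewrite !hornerE.
have p0 y : 0 <= p.[y] by rewrite pE mulr_ge0 ?sqr_ge0 ?prodr_ge0 // => i _; rewrite sqr_ge0.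
have px i : p.[x i] = 0 by rewrite pE (bigD1 i) //= subrr expr0n /= mul0r mulr0.
have [|A [B [hA hB AB]]] := @same_integral_root0 p; first by rewrite pE expr0n mul0r.
have {}AB : A + B = 0 by rewrite AB big1 ?mulr0.
have root_p y : p.[y] = 0 -> y = 0 \/ exists i, y = x i.
  rewrite pE => /eqP; rewrite mulf_eq0 sqrf_eq0 => /orP[/eqP->|]; first by left.
  move=> /prodf_eq0[i _]; rewrite sqrf_eq0 subr_eq0 => /eqP->; by right; exists i.
have lim_ge0 (a : nat -> K) (l : K) : (forall i, 0 <= a i) -> series a @ \oo --> l -> 0 <= l.
  move=> a0 al; have <- : limn (series a) = l by exact: cvg_lim al.
  apply: limr_ge; first by apply/cvg_ex; exists l.
  by near=> n; apply: sumr_ge0.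
have a0 i : 0 <= alpha i * p.[alpha i] by rewrite mulr_ge0.
have b0 i : 0 <= beta i * p.[- beta i] by rewrite mulr_ge0.
have A0 := lim_ge0 _ _ a0 hA; have B0 := lim_ge0 _ _ b0 hB.
split.
- have A_le0 : A <= 0 by lra.
  have /eqP := nonneg_series_eq0 a0 hA A_le0 j; rewrite mulf_eq0.
  by case/orP => /eqP; [left | exact: root_p].
- have B_le0 : B <= 0 by lra.
  have /eqP := nonneg_series_eq0 b0 hB B_le0 j; rewrite mulf_eq0.
  case/orP => /eqP; first by left.
  by case/root_p => [/eqP|]; [rewrite oppr_eq0 => /eqP; left | right].
Unshelve. all: by end_near. Qed.

Lemma thoma_param_nat j :
  d%:R * alpha j \is a Num.nat /\ d%:R * beta j \is a Num.nat.
Proof.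
have xn i (a : K) : 0 <= a -> `|x i| = a -> d%:R * a \is a Num.nat.
  by move=> a0 <-; have [k [_ ->]] := x_int i; exact: natr_nat.
have [ha hb] := thoma_in_spectrum j; split.
- case: ha => [->|[i aE]]; first by rewrite mulr0 rpred0.
  by apply: (xn i) => //; rewrite -aE ger0_norm.
- case: hb => [->|[i bE]]; first by rewrite mulr0 rpred0.
  by apply: (xn i) => //; rewrite -bE normrN ger0_norm.
Qed.

Lemma nat_ge_inv (a : K) : d%:R * a \is a Num.nat -> a != 0 -> 0 <= a -> d%:R^-1 <= a.
Proof.
move=> /natrP[k ak] a_neq0 a0; have dK : 0 < d%:R :> K by rewrite ltr0n.
rewrite -(ler_pM2l dK) mulfV ?gt_eqF // ak ler1n lt0n -(eqr_nat K) -ak.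
by rewrite mulf_neq0 // gt_eqF.
Qed.

(** A nonzero term is at least 1/d. If [a j] were nonzero for some j >= d, monotonicity would give
    d+1 such terms, with sum above 1. *)
Lemma finite_thoma_support (a : nat -> K) : (forall i, 0 <= a i.+1 <= a i) ->
    (forall n, \sum_(0 <= i < n) a i <= 1) -> (forall i, d%:R * a i \is a Num.nat) ->
  forall j, (d <= j)%N -> a j = 0.
Proof.
move=> a_dec a_sum a_nat j dj; apply/eqP/negPn/negP => aj.
have a0 := thoma_ge0 a_dec; have dK : 0 < d%:R :> K by rewrite ltr0n.
have a_mono i k : (i <= k)%N -> a k <= a i.
  elim: k => [|k IH]; first by rewrite leqn0 => /eqP->.
  rewrite leq_eqVlt => /predU1P[->//|/IH]; apply: le_trans.
  by case/andP: (a_dec k).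
have lower i : (i < d.+1)%N -> d%:R^-1 <= a i.
  rewrite ltnS => id; apply: le_trans (a_mono i j (leq_trans id dj)).
  exact: nat_ge_inv.
have := a_sum d.+1; apply/negP; rewrite -ltNge.
apply: (@lt_le_trans _ _ (\sum_(0 <= i < d.+1) d%:R^-1)).
  rewrite sumr_const_nat subn0 mulrS -[d%:R^-1 *+ d]mulr_natl mulfV ?gt_eqF //.
  by rewrite ltrDr invr_gt0.
by rewrite !big_mkord; apply: ler_sum => i _; exact: lower.
Qed.

Lemma thoma_finite :
  finite_set [set i | alpha i != 0] /\ finite_set [set j | beta j != 0].
Proof.
have [ha hb _] := thoma.
by split; apply: sub_finite_set (finite_II d) => i /=; apply: contraR; rewrite -leqNgt => di;
  rewrite (@finite_thoma_support _ _ _ _ i di) // => j; case: (thoma_param_nat j).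
Qed.

Lemma eseries_limE (a : nat -> K) (A : K) : series a @ \oo --> A ->
  (\sum_(i <oo) (a i)%:E)%E = A%:E.
Proof.
move=> aA; have <- : limn (series a) = A by exact: cvg_lim aA.
rewrite -EFin_lim; last by apply/cvg_ex; exists A.
by congr (limn _); apply/funext => n; rewrite /= sumEFin.
Qed.

(** The polynomial 1 - prod (1 - y / x_i), defined because no x_i is 0, vanishes at 0 and equals 1
    on the spectrum. Its integral is the total weight on one side and 1 on the other. *)
Lemma thoma_sum1 : (\sum_(i <oo) (alpha i)%:E + \sum_(j <oo) (beta j)%:E = 1)%E.
Proof.
pose p : {poly K} := 1 - \prod_i (1 - (x i)^-1 *: 'X).
have pE y : p.[y] = 1 - \prod_i (1 - (x i)^-1 * y).
  rewrite !hornerE horner_prod; congr (_ - _).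
  by apply: eq_bigr => i _; rewrite !hornerE.
have px i : p.[x i] = 1.
  by rewrite pE (bigD1 i) //= mulVf // subrr mul0r subr0.
have [|A [B [hA hB AB]]] := @same_integral_root0 p.
  by rewrite pE big1 ?subrr // => i _; rewrite mulr0 subr0.
have dK : d%:R != 0 :> K by rewrite pnatr_eq0 -lt0n.
have {}AB : A + B = 1.
  by rewrite AB (eq_bigr (fun=> 1)) // sumr_const card_ord mulVf.
have aE : (fun j => alpha j * p.[alpha j]) = alpha.
  apply/funext => j; have [[->|[i ->]] _] := thoma_in_spectrum j; first by rewrite mul0r.
  by rewrite px mulr1.
have bE : (fun j => beta j * p.[- beta j]) = beta.
  apply/funext => j; have [_ [->|[i E]]] := thoma_in_spectrum j; first by rewrite mul0r.
  by rewrite E px mulr1.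
by rewrite aE in hA; rewrite bE in hB; rewrite (eseries_limE hA) (eseries_limE hB) -EFinD AB.
Qed.

End ThomaSpectrum.

(** * Construction of R-matrices *)

Section Monomial.
Variable A : comPzRingType.

(** Sends the basis vector e_j to s j times e_(f j), so that matrix identities become checks on
    indices and scalars. *)
Definition monomial_mx n (f : 'I_n -> 'I_n) (s : 'I_n -> A) : 'M[A]_n :=
  \matrix_(i, j) (s j *+ (i == f j)).

Lemma monomial_mxM n (f g : 'I_n -> 'I_n) (s u : 'I_n -> A) :
  monomial_mx f s *m monomial_mx g u = monomial_mx (f \o g) (fun j => s (g j) * u j).
Proof.
apply/matrixP => i j; rewrite !mxE (bigD1 (g j)) //= big1 ?addr0 => [|k kg].
  by rewrite !mxE eqxx mulr1n mulrnAl.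
by rewrite !mxE (negbTE kg) mulr0n mulr0.
Qed.

Lemma eq_monomial_mx n (f g : 'I_n -> 'I_n) (s u : 'I_n -> A) :
  (forall j, f j = g j /\ s j = u j) -> monomial_mx f s = monomial_mx g u.
Proof. by move=> h; apply/matrixP => i j; rewrite !mxE; have [-> ->] := h j. Qed.

Lemma monomial_mx1 n : 1%:M = monomial_mx (@id 'I_n) (fun=> 1 : A).
Proof. by apply/matrixP => i j; rewrite !mxE. Qed.

Definition tens_fun m n (f : 'I_m -> 'I_m) (g : 'I_n -> 'I_n) (p : 'I_(m * n)) :=
  mxtens_index (f (mxtens_unindex p).1, g (mxtens_unindex p).2).

Lemma monomial_mx_tens m n (f : 'I_m -> 'I_m) (g : 'I_n -> 'I_n) (s : 'I_m -> A) (u : 'I_n -> A) :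
  monomial_mx f s *t monomial_mx g u = monomial_mx (tens_fun f g)
    (fun p => s (mxtens_unindex p).1 * u (mxtens_unindex p).2).
Proof.
apply/matrixP => p q; case: (mxtens_indexP p) => p1 p2.
rewrite !mxE mxtens_indexK /= (inj_eq (can_inj (@mxtens_indexK _ _))) xpair_eqE.
by do 2![case: eqP => _]; rewrite ?mulr1n ?mulr0n ?mulr0 ?mul0r.
Qed.

Lemma castmx_monomial m n (e : m = n) (f : 'I_m -> 'I_m) (s : 'I_m -> A) :
  castmx (e, e) (monomial_mx f s) =
  monomial_mx (fun j => cast_ord e (f (cast_ord (esym e) j))) (fun j => s (cast_ord (esym e) j)).
Proof.
case: n / e; rewrite castmx_id; apply: eq_monomial_mx => j.
by rewrite !cast_ord_id.
Qed.

End Monomial.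

(* The R-matrix acting on e_a (x) e_b as the scalar [sg (col a)] if [a] and [b] have
   the same colour, and as the flip otherwise. *)
Section ColourRMatrix.
Variables (K : realType) (D : nat) (T : eqType) (col : 'I_D -> T) (sg : T -> bool).
Local Notation C := K[i].
Local Notation idx a b := (mxtens_index (a, b)).

Definition colour_fun (p : 'I_(D * D)) : 'I_(D * D) :=
  let: (a, b) := mxtens_unindex p in if col a == col b then p else idx b a.
Definition colour_sign (p : 'I_(D * D)) : C :=
  let: (a, b) := mxtens_unindex p in if col a == col b then (-1) ^+ sg (col a) else 1.

Definition colour_mx : 'M[C]_(D * D) := monomial_mx colour_fun colour_sign.

Lemma colour_funE a b : colour_fun (idx a b) = if col a == col b then idx a b else idx b a.
Proof. by rewrite /colour_fun mxtens_indexK. Qed.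

Lemma colour_signE a b :
  colour_sign (idx a b) = if col a == col b then (-1) ^+ sg (col a) else 1.
Proof. by rewrite /colour_sign mxtens_indexK. Qed.

Lemma colour_funK : involutive colour_fun.
Proof.
move=> p; case: (mxtens_indexP p) => a b; rewrite colour_funE.
have [E|/negbTE E] := eqVneq (col a) (col b); first by rewrite colour_funE E eqxx.
by rewrite colour_funE eq_sym E.
Qed.

Lemma colour_sign_fun p : colour_sign (colour_fun p) = colour_sign p.
Proof.
case: (mxtens_indexP p) => a b; rewrite colour_funE.
have [//|/negbTE E] := eqVneq (col a) (col b).
by rewrite !colour_signE eq_sym E.
Qed.

Lemma colour_sign_sq p : colour_sign p * colour_sign p = 1.
Proof.
case: (mxtens_indexP p) => a b; rewrite colour_signE; case: ifP => _; last exact: mulr1.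
by rewrite -signr_addb addbb.
Qed.

Lemma colour_mx_invol : colour_mx *m colour_mx = 1%:M.
Proof.
rewrite monomial_mxM monomial_mx1; apply: eq_monomial_mx => p /=.
by rewrite colour_funK colour_sign_fun colour_sign_sq.
Qed.

Lemma colour_mx_selfadjoint : selfadjoint colour_mx.
Proof.
apply/matrixP => p q; rewrite daggerE !mxE.
have -> : (q == colour_fun p) = (p == colour_fun q).
  by apply/eqP/eqP => ->; rewrite colour_funK.
case: eqP => [->|_]; last by rewrite !mulr0n rmorph0.
rewrite !mulr1n colour_sign_fun; case: (mxtens_indexP q) => a b; rewrite colour_signE.
by case: ifP => _; rewrite ?rmorph_sign ?rmorph1.
Qed.

Let idx3 (a b c : 'I_D) : 'I_(D * D * D) := idx (idx a b) c.

Lemma colour_mx_yang_baxter : yang_baxter colour_mx.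
Proof.
rewrite /yang_baxter /= (monomial_mx1 C D) !monomial_mx_tens.
rewrite castmx_monomial.
set f12 := tens_fun _ _; set s12 := fun p => _ * _; set f23 := fun j => cast_ord _ _.
set s23 := fun j => _ * _.
have f12E a b c : f12 (idx3 a b c) = if col a == col b then idx3 a b c else idx3 b a c.
  by rewrite /f12 /tens_fun mxtens_indexK /= colour_funE; case: ifP.
have s12E a b c : s12 (idx3 a b c) = if col a == col b then (-1) ^+ sg (col a) else 1.
  by rewrite /s12 mxtens_indexK /= colour_signE mulr1.
have castE a b c : cast_ord (esym (mulnA D D D)) (idx3 a b c) = idx a (idx b c).
  by apply: val_inj; rewrite /= mulnDl addnA mulnA.
have castE' a b c : cast_ord (mulnA D D D) (idx a (idx b c)) = idx3 a b c.
  by apply: val_inj; rewrite /= mulnDl addnA mulnA.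
have f23E a b c : f23 (idx3 a b c) = if col b == col c then idx3 a b c else idx3 a c b.
  by rewrite /f23 castE /tens_fun mxtens_indexK /= colour_funE; case: ifP; rewrite castE'.
have s23E a b c : s23 (idx3 a b c) = if col b == col c then (-1) ^+ sg (col b) else 1.
  by rewrite /s23 castE mxtens_indexK /= colour_signE mul1r.
rewrite !monomial_mxM; apply: eq_monomial_mx => p.
case: (mxtens_indexP p) => q c; case: (mxtens_indexP q) => a b; rewrite -/(idx3 a b c) /=.
have simp := (f12E, f23E, s12E, s23E).
(* Only the coincidences among the three colours matter; [congruence] discards the patterns that
   violate transitivity. *)
have [ab|/eqP ab] := eqVneq (col a) (col b); have [bc|/eqP bc] := eqVneq (col b) (col c);
  have [ac|/eqP ac] := eqVneq (col a) (col c); try congruence;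
  have sym := (eq_sym (col b) (col a), eq_sym (col c) (col a), eq_sym (col c) (col b));
  move/eqP: ab => ab; move/eqP: bc => bc; move/eqP: ac => ac;
  do ?[rewrite ?simp ?sym ?ab ?bc ?ac ?(negbTE ab) ?(negbTE bc) ?(negbTE ac) ?eqxx /=].
all: split=> //; try rewrite (eqP ab); try rewrite (eqP ac); rewrite ?mul1r ?mulr1 //.
all: try by rewrite (eqP bc).
Qed.

Lemma colour_mx_involutive_Rmatrix : involutive_Rmatrix colour_mx.
Proof.
split; last exact: colour_mx_yang_baxter; last exact: colour_mx_invol.
apply/unitarymxP; rewrite -[X in _ *m X]/(dagger colour_mx).
by rewrite colour_mx_selfadjoint colour_mx_invol.
Qed.

Definition colour_eigenvalue (a : 'I_D) : K :=
  (-1) ^+ sg (col a) * (\sum_b (col b == col a))%:R / D%:R.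

(** A vector of another colour in the second factor is flipped away and contributes nothing, so t is
    already diagonal. The form [conj_diag 1%:M] gives access to the formulas for powers and
    traces. *)
Lemma ptr_colour_mx : ptr_r colour_mx = conj_diag 1%:M (fun a => (colour_eigenvalue a)%:C%C).
Proof.
rewrite /conj_diag invmx1 mul1mx mulmx1; apply/matrixP => a b; rewrite !mxE.
have entry k : colour_mx (idx a k) (idx b k) =
    (if col k == col b then (-1) ^+ sg (col b) else 0) *+ (a == b).
  rewrite mxE colour_signE colour_funE [col k == _]eq_sym.
  case: (eqVneq (col b) (col k)) => [_|E].
    by rewrite (inj_eq (can_inj (@mxtens_indexK _ _))) xpair_eqE eqxx andbT.
  rewrite (inj_eq (can_inj (@mxtens_indexK _ _))) xpair_eqE mul0rn.
  by case: (eqVneq k b) E => [->|]; rewrite ?eqxx ?andbF.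
under eq_bigr do rewrite entry.
case: (eqVneq a b) => [->|_]; last by rewrite !mulr0n big1 ?mulr0.
rewrite !mulr1n (eq_bigr (fun k => (-1) ^+ sg (col b) * (col k == col b)%:R)); last first.
  by move=> k _; case: ifP => _; rewrite ?mulr1 ?mulr0 ?mulr1n.
rewrite -mulr_sumr -natr_sum mulrC /colour_eigenvalue.
by rewrite !rmorphM fmorphV rmorph_sign !rmorph_nat.
Qed.

Lemma tr_ptr_colour_mx n :
  \tr (iter n (mulmx (ptr_r colour_mx)) 1%:M) = (\sum_a colour_eigenvalue a ^+ n)%:C%C.
Proof.
have U1 : (1%:M : 'M[C]_D) \in unitmx by exact: unitmx1.
rewrite ptr_colour_mx (conj_diag_iter U1) (tr_conj_diag U1) rmorph_sum.
by apply: eq_bigr => a _; rewrite rmorphXn.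
Qed.

End ColourRMatrix.

(** * Rational Thoma parameters as block sizes *)

Lemma support_bound (K : realType) (a : nat -> K) :
  finite_set [set i | a i != 0] -> exists n, forall i, (n <= i)%N -> a i = 0.
Proof.
move=> /finite_seqP[X EX]; exists (\max_(i <- X) i).+1 => i hi.
apply/eqP/negPn/negP => ai; have iX : [set` X] i by rewrite -EX.
have /= := leq_bigmax_seq (P := xpredT) (F := fun i : nat => i) _ iX isT.
by rewrite leqNgt hi.
Qed.

Lemma series_finite_support (K : realType) (a : nat -> K) n :
  (forall i, (n <= i)%N -> a i = 0) -> series a @ \oo --> \sum_(0 <= i < n) a i.
Proof.
move=> a0; apply: cvg_near_cst; exists n => // m /= nm.
rewrite /series /= (big_cat_nat (n := n)) //= [X in _ + X]big_nat_cond.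
by rewrite [X in _ + X]big1 ?addr0 // => i /andP[/andP[ni _] _]; exact: a0.
Qed.

Lemma common_denominator (K : realType) (a : nat -> K) n :
    (forall i, 0 <= a i) -> (forall i, exists q : rat, a i = ratr q) ->
  exists D : nat, (0 < D)%N /\ forall i, (i < n)%N -> D%:R * a i \is a Num.nat.
Proof.
move=> a0 aQ; elim: n => [|n [D [D0 hD]]]; first by exists 1%N.
have [q aq] := aQ n; exists (D * `|denq q|)%N; split.
  by rewrite muln_gt0 D0 absz_gt0 denq_eq0.
have den : `|denq q|%:R * a n = (numq q)%:~R.
  rewrite aq /ratr mulrCA -[_%:R]/(`|denq q|%:Z%:~R) absz_denq divff ?mulr1 //.
  by rewrite intr_eq0 denq_eq0.
have q0 : (0 <= numq q)%R by rewrite -(ler0z K) -den mulr_ge0.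
move=> i; rewrite ltnS leq_eqVlt => /predU1P[->|/hD Di].
  by rewrite natrM -mulrA den -(gez0_abs q0) -natrM natr_nat.
by rewrite mulnC natrM -mulrA; apply: rpredM => //; exact: natr_nat.
Qed.

Section Realization.
Variables (K : realType) (alpha beta : nat -> K) (n D : nat) (a b : nat -> nat).
Hypothesis D_gt0 : (0 < D)%N.
Hypothesis aE : forall i, (a i)%:R = D%:R * alpha i.
Hypothesis bE : forall i, (b i)%:R = D%:R * beta i.
Hypothesis sum1 : (\sum_(0 <= i < n) a i + \sum_(0 <= i < n) b i = D)%N.

(* The colour (false, i), resp. (true, j), is used [a i], resp. [b j], times. *)
Let word : seq (bool * nat) :=
  flatten [seq nseq (a i) (false, i) | i <- iota 0 n] ++
  flatten [seq nseq (b i) (true, i) | i <- iota 0 n].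

(** The default value is never reached: [word] has length [D] by [size_word]. *)
Let colour (k : 'I_D) := nth (false, 0%N) word k.

Lemma sum_word (V : nmodType) (F : bool * nat -> V) :
  \sum_(z <- word) F z =
  \sum_(0 <= i < n) F (false, i) *+ a i + \sum_(0 <= i < n) F (true, i) *+ b i.
Proof.
rewrite /word big_cat !big_flatten !big_map /index_iota subn0.
by congr (_ + _); apply: eq_bigr => i _; rewrite big_nseq iter_addr addr0.
Qed.

Lemma size_word : size word = D.
Proof.
have -> : size word = (\sum_(z <- word) 1)%N by rewrite sum1_size.
have := sum_word (fun=> 1%N); rewrite -[in LHS]/(\sum_(z <- word) 1)%N => ->.
by rewrite -[RHS]sum1; congr addn; apply: eq_bigr => i _; exact: natn.
Qed.

Lemma sum_colour (V : nmodType) (F : bool * nat -> V) :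
  \sum_k F (colour k) = \sum_(z <- word) F z.
Proof. by rewrite (big_nth (false, 0%N)) big_mkord size_word. Qed.

Let mult (z : bool * nat) : nat := (\sum_k (colour k == z))%N.

Lemma multE (e : bool) i : (i < n)%N -> mult (e, i) = if e then b i else a i.
Proof.
move=> ni; rewrite /mult [LHS](sum_colour (fun z => (z == (e, i)) : nat)) [LHS]sum_word.
have pick (c : nat -> nat) : \sum_(0 <= j < n) ((j == i) : nat) *+ c j = c i.
  rewrite big_mkord (bigD1 (Ordinal ni)) //= eqxx big1 ?addr0 => [|j ji]; first exact: natn.
  by rewrite -[j == i :> nat]/(j == Ordinal ni) (negbTE ji) mul0rn.
have none (c : nat -> nat) : \sum_(0 <= j < n) (0%N *+ c j) = 0%N.
  by rewrite big1 // => j _; rewrite mul0rn.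
have -> : \sum_(0 <= j < n) (((false, j) == (e, i)) : nat) *+ a j = if e then 0%N else a i.
  by case: e; [exact: none | exact: pick].
have -> : \sum_(0 <= j < n) (((true, j) == (e, i)) : nat) *+ b j = if e then b i else 0%N.
  by case: e; [exact: pick | exact: none].
by case: e; rewrite ?add0r ?addr0.
Qed.

Local Notation R := (colour_mx K colour fst).

(** A block of a_i = D alpha_i vectors carries the eigenvalue alpha_i with that multiplicity, so the
    average over [D] contributes alpha_i * alpha_i^p; a block of the second kind likewise, with
    eigenvalue - beta_i. *)
Lemma moments_colour p :
  D%:R^-1 * \sum_k colour_eigenvalue K colour fst k ^+ p =
  \sum_(0 <= i < n) alpha i ^+ p.+1 + (-1) ^+ p * \sum_(0 <= i < n) beta i ^+ p.+1.
Proof.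
have D0 : D%:R != 0 :> K by rewrite pnatr_eq0 -lt0n.
pose G (z : bool * nat) : K := (-1) ^+ z.1 * (mult z)%:R / D%:R.
rewrite [X in _ * X](sum_colour (fun z => G z ^+ p)) sum_word mulrDr; congr (_ + _).
  rewrite mulr_sumr; apply: eq_big_nat => i /andP[_ ni].
  rewrite /G multE //= mul1r aE mulrAC divff // mul1r -[_ *+ a i]mulr_natr aE.
  by rewrite mulrC -mulrA mulrAC -!mulrA mulVKf // -exprSr.
rewrite !mulr_sumr; apply: eq_big_nat => i /andP[_ ni].
rewrite /G multE //= mulN1r bE mulNr mulrAC divff // mul1r -[_ *+ b i]mulr_natr bE.
rewrite (exprNn (beta i)).
by rewrite -mulrA mulrCA; congr (_ * _); rewrite mulrCA mulKf // -exprSr.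
Qed.

Hypothesis alpha0 : forall i, (n <= i)%N -> alpha i = 0.
Hypothesis beta0 : forall i, (n <= i)%N -> beta i = 0.

Lemma thoma_value_finite p : thoma_value alpha beta p.+1 =
  \sum_(0 <= i < n) alpha i ^+ p.+1 + (-1) ^+ p * \sum_(0 <= i < n) beta i ^+ p.+1.
Proof.
have lim_pow (c : nat -> K) : (forall i, (n <= i)%N -> c i = 0) ->
    limn (series (fun i => c i ^+ p.+1)) = \sum_(0 <= i < n) c i ^+ p.+1.
  move=> c0; apply: cvg_lim => //; apply: series_finite_support => i /c0->.
  by rewrite expr0n.
by rewrite /thoma_value !lim_pow // !exprS !mulN1r opprK.
Qed.

(** Both characters are multiplicative over disjoint cycles, so it is enough to compare them on one
    cycle and to peel off a cycle decomposition. *)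
Lemma colour_character (chi : Sinf -> K[i]) :
  thoma_parameters chi alpha beta -> chi = yb_char R.
Proof.
move=> [_ chi_cycle chi_prod]; have hR := colour_mx_involutive_Rmatrix K colour fst.
have cycle_value m c : (2 <= m)%N -> is_ncycle m c ->
    \tr (iter m.-1 (mulmx (ptr_r R)) 1%:M) / D%:R = chi c.
  move=> m2 cm; rewrite (chi_cycle m) // tr_ptr_colour_mx.
  have -> : m = m.-1.+1 by rewrite prednK // ltnW.
  by rewrite thoma_value_finite -moments_colour rmorphM fmorphV rmorph_nat mulrC.
apply/funext => s; have [m [_ hs]] := sinf_stab_ex s.
have [cs [cyc_cs dis_cs -> _]] := cycle_decomposition hs.
rewrite chi_prod //.
elim: cs cyc_cs dis_cs => [|c cs IH] cyc_cs /=; first by rewrite !big_nil yb_char1.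
move=> /andP[/allP c_dis dis_cs].
have [p p2 cp] := cyc_cs c (mem_head _ _); have [l [Ul lp cl]] := cp.
rewrite !big_cons (yb_char_cycle D_gt0 hR Ul _ cl) ?lp; last 2 first.
- exact: ltnW.
- move=> i il; apply: prod_fix => c' c'cs.
  have [ci|//] := asboolP _ (c_dis c' c'cs) i.
  by case: (next_neq Ul _ il); rewrite ?lp // -cl.
rewrite (cycle_value p c p2 cp) [LHS]mulrC; apply: (congr1 ( *%R^~ (chi c))).
by apply: IH => // c' c'cs; apply: cyc_cs; rewrite inE c'cs orbT.
Qed.

End Realization.

(** * Moments of the partial trace and the equivalence *)

Lemma yb_thoma_moments (K : realType) (d : nat) (R : 'M[K[i]]_(d * d)) (alpha beta : nat -> K)
    (x : 'I_d -> K) : (0 < d)%N -> involutive_Rmatrix R ->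
    thoma_parameters (yb_char R) alpha beta ->
    (forall n, \tr (iter n (mulmx (ptr_r R)) 1%:M) = (\sum_i x i ^+ n)%:C%C) ->
  forall n, thoma_value alpha beta n.+2 = d%:R^-1 * \sum_i x i ^+ n.+1.
Proof.
move=> d0 hR [_ chi_cycle _] tr_x n; apply: (fmorph_inj (real_complex K)).
have Ul : uniq (iota 0 n.+2) := iota_uniq 0 n.+2.
have zE : std_cycle 0 n.+1 =1 next (iota 0 n.+2) by move=> i; rewrite next_iota.
have cyc : is_ncycle n.+2 (std_cycle 0 n.+1).
  by exists (iota 0 n.+2); rewrite size_iota.
rewrite -[LHS](chi_cycle _ _ _ cyc) // -[std_cycle 0 n.+1]mulg1.
rewrite (yb_char_cycle d0 hR Ul _ zE) ?size_iota // (yb_char1 d0 hR) mul1r tr_x.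
by rewrite rmorphM fmorphV rmorph_nat mulrC.
Qed.

Theorem theorem3 (K : realType) :
  (forall (chi : Sinf -> K[i]) (alpha beta : nat -> K),
     extremal_character chi -> thoma_parameters chi alpha beta ->
     (is_yb_character chi <->
      [/\ finite_set [set i | alpha i != 0] /\ finite_set [set j | beta j != 0],
          (\sum_(i <oo) (alpha i)%:E + \sum_(j <oo) (beta j)%:E = 1)%E &
          (forall i, exists q : rat, alpha i = ratr q) /\
          (forall j, exists q : rat, beta j = ratr q)]))
  /\
  (forall (d : nat) (R : 'M[K[i]]_(d * d)) (alpha beta : nat -> K),
     (0 < d)%N -> involutive_Rmatrix R ->
     thoma_parameters (yb_char R) alpha beta ->
     forall i, d%:R * alpha i \is a Num.nat /\ d%:R * beta i \is a Num.nat).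
Proof.
have nat_params (d : nat) (R : 'M[K[i]]_(d * d)) (alpha beta : nat -> K) :
    (0 < d)%N -> involutive_Rmatrix R -> thoma_parameters (yb_char R) alpha beta ->
    forall i, d%:R * alpha i \is a Num.nat /\ d%:R * beta i \is a Num.nat.
  move=> d0 hR thoma; have [x [x_int tr_x]] := ptr_spectrum d0 hR.
  have mom := yb_thoma_moments d0 hR thoma tr_x; have [dom _ _] := thoma.
  exact: thoma_param_nat dom x_int mom.
split=> [chi alpha beta _ thoma|]; last exact: nat_params.
have [dom _ _] := thoma; have [/thoma_ge0 alpha_ge0 /thoma_ge0 beta_ge0 _] := dom.
split=> [[d [R [d0 hR chiE]]]|[[fin_a fin_b] sum1 [rat_a rat_b]]].
  rewrite chiE in thoma.
  have [x [x_int tr_x]] := ptr_spectrum d0 hR.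
  have mom := yb_thoma_moments d0 hR thoma tr_x.
  have dK : d%:R != 0 :> K by rewrite pnatr_eq0 -lt0n.
  have ratP (y : K) : d%:R * y \is a Num.nat -> exists q : rat, y = ratr q.
    move=> /natrP[k dy]; exists (k%:R / d%:R).
    by rewrite fmorph_div !rmorph_nat -dy mulrC mulKf.
  split; [exact: thoma_finite d0 dom x_int mom | exact: thoma_sum1 d0 dom x_int mom |].
  by split=> j; apply: ratP; case: (nat_params d R alpha beta d0 hR thoma j).
have [na a0] := support_bound fin_a; have [nb b0] := support_bound fin_b.
pose n := maxn na nb.
have {}a0 i : (n <= i)%N -> alpha i = 0.
  by move=> ni; apply: a0; apply: leq_trans ni; exact: leq_maxl.
have {}b0 i : (n <= i)%N -> beta i = 0.
  by move=> ni; apply: b0; apply: leq_trans ni; exact: leq_maxr.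
have [Da [Da0 hDa]] := common_denominator n alpha_ge0 rat_a.
have [Db [Db0 hDb]] := common_denominator n beta_ge0 rat_b.
(* A common denominator of all parameters, which becomes the dimension of the R-matrix. *)
pose D := (Da * Db)%N; have D0 : (0 < D)%N by rewrite muln_gt0 Da0.
have /choice[a aE] : forall i, exists k : nat, k%:R = D%:R * alpha i.
  move=> i; have [ni|ni] := leqP n i; first by exists 0%N; rewrite a0 // mulr0.
  have /natrP[k kE] := hDa i ni; exists (Db * k)%N.
  by rewrite natrM -kE mulrA -natrM mulnC.
have /choice[b bE] : forall i, exists k : nat, k%:R = D%:R * beta i.
  move=> i; have [ni|ni] := leqP n i; first by exists 0%N; rewrite b0 // mulr0.
  have /natrP[k kE] := hDb i ni; exists (Da * k)%N.
  by rewrite natrM -kE mulrA -natrM.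
(* Scaled by [D], condition (ii) says that the blocks exactly fill C^D. *)
have sumD : (\sum_(0 <= i < n) a i + \sum_(0 <= i < n) b i = D)%N.
  apply/eqP; rewrite -(eqr_nat K) natrD !natr_sum.
  rewrite (eq_bigr (fun i => D%:R * alpha i)) => [|i _]; last exact: aE.
  rewrite [X in _ + X](eq_bigr (fun i => D%:R * beta i)) => [|i _]; last exact: bE.
  rewrite -!mulr_sumr -mulrDr; move: sum1.
  rewrite (eseries_limE (series_finite_support a0)) (eseries_limE (series_finite_support b0)).
  by rewrite -EFinD => -[->]; rewrite mulr1.
(* The colouring is [colour] from the realization, with its local definitions unfolded. *)
exists D, (colour_mx K (fun k : 'I_D => nth (false, 0%N)
  (flatten [seq nseq (a i) (false, i) | i <- iota 0 n] ++
   flatten [seq nseq (b i) (true, i) | i <- iota 0 n]) k) fst); split=> //.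
  exact: colour_mx_involutive_Rmatrix.
exact: (colour_character D0 aE bE sumD a0 b0 thoma).
Qed.
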